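(* Let $\psi(s)=c_0s+\varphi(s)\in\mathfrak{G}_{\geq 1}$ and suppose that $C_\psi$ is a compact operator on $\mathcal{H}^2$. Then $C_\psi$ is compact on $\mathcal{H}^2_\Lambda$.
   Context: For $\theta\in\mathbb{R}$, $\mathbb{C}_\theta=\{z\in\mathbb{C}:\operatorname{Re}z>\theta\}$. Generalized integers: let $\{p_n\}_{n\ge1}$ be the increasing sequence of (ordinary) primes and let $\{q_n\}_{n\ge1}$ be an increasing, unbounded sequence of real numbers, each greater than $1$, such that the set $\{\log p_n\}_{n\ge1}\cup\{\log q_n\}_{n\ge1}$ is $\mathbb{Q}$-linearly independent. Let $\{\lambda_n\}_{n\ge1}$ be the increasing enumeration of all finite products (with repetition allowed, including the empty product $1$) of elements of $\{p_n\}\cup\{q_n\}$. $\mathcal{H}^2_\Lambda$ is the Hilbert space of (formal) generalized Dirichlet series $f(s)=\sum_{n\ge1}a_n\lambda_n^{-s}$ with norm $\|f\|^2=\sum_{n\ge1}|a_n|^2<\infty$. $\mathcal{H}^2$ is the subspace of ordinary Dirichlet series $\sum_{n\ge1}a_nn^{-s}$ with $\sum|a_n|^2<\infty$; its elements are holomorphic in $\mathbb{C}_{1/2}$. The class $\mathfrak{G}_{\ge1}$ consists of all functions $\psi(s)=c_0s+\varphi(s)$ where $c_0\ge1$ is an integer and $\varphi(s)=\sum_{n\ge1}c_nn^{-s}$ is an ordinary Dirichlet series, converging uniformly in $\mathbb{C}_\varepsilon$ for every $\varepsilon>0$, such that either $\varphi(\mathbb{C}_0)\subset\mathbb{C}_0$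 or $\varphi\equiv i\tau$ for some $\tau\in\mathbb{R}$. The composition operator is $C_\psi f=f\circ\psi$; for $\psi\in\mathfrak{G}_{\ge1}$ it is bounded on $\mathcal{H}^2$ with norm one (Gordon–Hedenmalm). On finite sums of terms $a_n\lambda_n^{-s}$ it is given by $\lambda_n^{-s}\mapsto\lambda_n^{-\psi(s)}=(\lambda_n^{c_0})^{-s}\lambda_n^{-\varphi(s)}\in\mathcal{H}^2_\Lambda$ (where $\lambda_n^{-\varphi(s)}$ is a bounded ordinary Dirichlet series on $\mathbb{C}_0$), and this extends to a bounded operator on $\mathcal{H}^2_\Lambda$, again denoted $C_\psi$. *)

(* Defs.v *)
From HB Require Import structures.
From mathcomp Require Import all_boot all_order all_algebra.
From mathcomp Require Import all_classical all_reals all_analysis.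
From mathcomp Require Import complex lra.

Set Implicit Arguments.
Unset Strict Implicit.
Unset Printing Implicit Defensive.

Import Order.TTheory GRing.Theory Num.Theory.
Import numFieldNormedType.Exports.
Import ComplexField.Normc.

Local Open Scope classical_set_scope.
Local Open Scope ring_scope.
Local Open Scope complex_scope.

Local Notation Re := complex.Re.
Local Notation Im := complex.Im.

(* The canonical topology of numeric fields is not inferred on R[i] itself. *)
HB.instance Definition _ (R : realType) := NormedModule.copy R[i] R[i]^o.

(* The Hilbert space of square-summable complex sequences, as a normed module
   over R[i]. A (formal) Dirichlet series is identified with its sequence of
   coefficients; indices start at 0. *)
Section SquareSummable.
Variable R : realType.
Implicit Types (a b : nat -> R[i]) (n : nat).

Definition sqsum a n : R := \sum_(0 <= k < n) normc (a k) ^+ 2.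

Definition square_summable : {pred nat -> R[i]} :=
  mem [set a | cvgn (sqsum a)].

Lemma sqsum_ge0 a n : 0 <= sqsum a n.
Proof. by apply: sumr_ge0 => k _; rewrite sqr_ge0. Qed.

Lemma sqsum_nd a : nondecreasing_seq (sqsum a).
Proof.
apply/nondecreasing_seqP => n.
by rewrite /sqsum big_nat_recr//= lerDl sqr_ge0.
Qed.

Lemma sqsum_is_cvg a M : (forall n, sqsum a n <= M) -> cvgn (sqsum a).
Proof.
move=> aM; apply: nondecreasing_is_cvgn; first exact: sqsum_nd.
by exists M => _ [n _ <-].
Qed.

Lemma sqsum_le_lim a n : a \in square_summable -> sqsum a n <= limn (sqsum a).
Proof.
by move=> /set_mem ca; apply: nondecreasing_cvgn_le => //; exact: sqsum_nd.
Qed.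

Lemma lim_sqsum_ge0 a : a \in square_summable -> 0 <= limn (sqsum a).
Proof. by move=> sa; rewrite (le_trans (sqsum_ge0 a 0))// sqsum_le_lim. Qed.

Lemma minkowski2 (A B c d : R) : 0 <= A -> 0 <= B -> 0 <= c -> 0 <= d ->
  (A + B) ^+ 2 + (c + d) ^+ 2 <=
  (Num.sqrt (A ^+ 2 + c ^+ 2) + Num.sqrt (B ^+ 2 + d ^+ 2)) ^+ 2.
Proof.
move=> A0 B0 c0 d0.
rewrite [leRHS]sqrrD !sqr_sqrtr ?addr_ge0 ?sqr_ge0//.
have : A * B + c * d <= Num.sqrt (A ^+ 2 + c ^+ 2) * Num.sqrt (B ^+ 2 + d ^+ 2).
  rewrite -sqrtrM ?addr_ge0 ?sqr_ge0// -[leLHS]ger0_norm ?addr_ge0 ?mulr_ge0//.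
  rewrite -sqrtr_sqr ler_wsqrtr//.
  have := sqr_ge0 (A * d - B * c); nra.
rewrite mulr2n; lra.
Qed.

Lemma sqsumD a b n :
  Num.sqrt (sqsum (a + b) n) <= Num.sqrt (sqsum a n) + Num.sqrt (sqsum b n).
Proof.
elim: n => [|n IH]; first by rewrite /sqsum !big_geq// sqrtr0 addr0.
rewrite /sqsum !big_nat_recr//= -!/(sqsum _ n).
set A := Num.sqrt (sqsum a n) in IH *.
set B := Num.sqrt (sqsum b n) in IH *.
have -> : sqsum a n = A ^+ 2 by rewrite sqr_sqrtr ?sqsum_ge0.
have -> : sqsum b n = B ^+ 2 by rewrite sqr_sqrtr ?sqsum_ge0.
rewrite -[leRHS]ger0_norm ?addr_ge0 ?sqrtr_ge0//.
rewrite -sqrtr_sqr ler_wsqrtr//.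
have nc0 (z : R[i]) : 0 <= normc z by case: z => x y; rewrite sqrtr_ge0.
apply: (le_trans _ (minkowski2 _ _ _ _)) => //; try exact: sqrtr_ge0.
apply: lerD.
  rewrite -(sqr_sqrtr (sqsum_ge0 (a + b) n)).
  by rewrite ler_sqr ?nnegrE ?addr_ge0 ?sqrtr_ge0.
by rewrite ler_sqr ?nnegrE ?addr_ge0 ?nc0//; exact: le_normcD.
Qed.

Lemma sqsumZ (l : R[i]) a n : sqsum (l *: a) n = normc l ^+ 2 * sqsum a n.
Proof.
by rewrite /sqsum mulr_sumr; apply: eq_bigr => k _; rewrite normcM exprMn.
Qed.

Lemma square_summable_submod : submod_closed square_summable.
Proof.
split=> [|l a b ca cb].
  apply/mem_set/(@sqsum_is_cvg _ 0) => n.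
  by rewrite /sqsum big1// => k _; rewrite normc0 expr0n.
apply/mem_set.
set S := Num.sqrt (normc l ^+ 2 * limn (sqsum a)) + Num.sqrt (limn (sqsum b)).
apply: (@sqsum_is_cvg _ (S ^+ 2)) => n.
rewrite -(sqr_sqrtr (sqsum_ge0 _ n)) ler_sqr ?nnegrE ?addr_ge0 ?sqrtr_ge0//.
apply: (le_trans (sqsumD _ _ _)).
rewrite sqsumZ lerD// ler_wsqrtr ?sqsum_le_lim//.
by rewrite ler_wpM2l ?sqr_ge0// sqsum_le_lim.
Qed.

HB.instance Definition _ :=
  GRing.isSubmodClosed.Build R[i] (nat -> R[i]) square_summable
    square_summable_submod.

Record l2 := L2 {
  l2_val :> nat -> R[i];
  l2_valP : l2_val \in square_summable }.

HB.instance Definition _ := [isSub of l2 for l2_val].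
HB.instance Definition _ := [Choice of l2 by <:].
HB.instance Definition _ := [SubChoice_isSubLmodule of l2 by <:].

Definition l2_norm (a : l2) : R[i] := (Num.sqrt (limn (sqsum a)))%:C.

Lemma l2_normD (a b : l2) : l2_norm (a + b) <= l2_norm a + l2_norm b.
Proof.
rewrite /l2_norm -rmorphD lecR.
set S := (X in _ <= X).
have S0 : 0 <= S by rewrite addr_ge0 ?sqrtr_ge0.
rewrite -[S]ger0_norm// -sqrtr_sqr ler_wsqrtr//.
apply: limr_le; first exact: set_mem (l2_valP (a + b)).
near=> n; rewrite -(sqr_sqrtr (sqsum_ge0 _ n)).
rewrite ler_sqr ?nnegrE ?sqrtr_ge0//.
apply: (le_trans (sqsumD _ _ _)).
by rewrite lerD// ler_wsqrtr ?sqsum_le_lim ?l2_valP.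
Unshelve. all: by end_near. Qed.

Lemma l2_normZ (l : R[i]) (a : l2) : l2_norm (l *: a) = `|l| * l2_norm a.
Proof.
rewrite /l2_norm.
have -> : sqsum (l *: a) = (fun n => normc l ^+ 2 * sqsum a n).
  by apply/funext => n; exact: sqsumZ.
have ca : cvgn (sqsum a) := set_mem (l2_valP a).
rewrite (_ : limn _ = normc l ^+ 2 * limn (sqsum a)); last first.
  by apply/cvg_lim => //; exact: cvgMr.
rewrite sqrtrM ?sqr_ge0// sqrtr_sqr ger0_norm; last first.
  by case: l => x y; rewrite sqrtr_ge0.
by rewrite rmorphM.
Qed.

Lemma l2_norm_eq0 (a : l2) : l2_norm a = 0 -> a = 0.
Proof.
move=> [] /eqP; rewrite sqrtr_eq0 => a0.
apply/val_inj/funext => n /=; apply: eq0_normc; apply/eqP.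
rewrite -sqrf_eq0 eq_le sqr_ge0 andbT (le_trans _ a0)//.
apply: le_trans (sqsum_le_lim n.+1 (l2_valP a)).
by rewrite /sqsum big_nat_recr//= lerDr sqsum_ge0.
Qed.

HB.instance Definition _ :=
  Lmodule_isNormed.Build R[i] l2 l2_normD l2_normZ l2_norm_eq0.

Lemma delta_square_summable n :
  (fun k => (k == n)%:R : R[i]) \in square_summable.
Proof.
apply/mem_set/(@sqsum_is_cvg _ 1) => m; rewrite /sqsum big_mkord.
have [nm|mn] := ltnP n m.
  rewrite (bigD1 (Ordinal nm))//= eqxx normc1 expr1n big1 ?addr0// => i.
  by rewrite -val_eqE /= => /negbTE ->; rewrite normc0 expr0n.
rewrite big1// => i _.
by rewrite ltn_eqF ?(leq_trans _ mn)// normc0 expr0n.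
Qed.

Definition l2_delta n : l2 := L2 (delta_square_summable n).

End SquareSummable.

Definition compact_operator (K : numFieldType) (V W : normedModType K)
    (T : V -> W) : Prop :=
  forall A : set V, bounded_set A -> precompact (T @` A).

Section Dirichlet.
Variable R : realType.
Implicit Types (s z : R[i]) (a : nat -> R[i]) (theta : R) (lam q : nat -> R).

Definition half_plane theta : set R[i] := [set s | theta < Re s].

Definition expC z : R[i] := (expR (Re z))%:C * (cos (Im z) +i* sin (Im z)).

(* The power x ^ s of a positive real number x. *)
Definition cpow (x : R) s : R[i] := expC (s * (ln x)%:C).

Definition dirichlet_psum lam a (N : nat) s : R[i] :=
  \sum_(0 <= n < N) a n * cpow (lam n) (- s).

Definition dirichlet_sum lam a s : R[i] :=
  limn (fun N => dirichlet_psum lam a N s).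

(* Frequencies of the ordinary Dirichlet series: the coefficient of index n is
   that of n.+1 ^ (- s). *)
Definition positive_integers (n : nat) : R := n.+1%:R.

Definition Q_linearly_independent (A : set R) : Prop :=
  forall (t : seq R) (c : R -> rat),
    uniq t -> (forall x, x \in t -> A x) ->
    \sum_(x <- t) ratr (c x) * x = 0 ->
    forall x, x \in t -> c x = 0.

Definition real_primes : set R := [set p%:R | p in [set p : nat | prime p]].

Definition admissible_generators q : Prop :=
  [/\ {homo q : m n / (m < n)%N >-> m < n},
      forall M, exists n, M < q n,
      forall n, 1 < q n &
      Q_linearly_independent
        ((@ln R @` real_primes) `|` range (fun n => ln (q n)))].

Definition generalized_integers q : set R :=
  [set \prod_(x <- t) x
    | t in [set t : seq R | forall x, x \in t -> (real_primes `|` range q) x]].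

Definition increasing_enumeration lam (A : set R) : Prop :=
  {homo lam : m n / (m < n)%N >-> m < n} /\ range lam = A.

(* The function psi(s) = c0 s + phi(s). *)
Definition symbol (c0 : nat) (phi : R[i] -> R[i]) s : R[i] :=
  c0%:R * s + phi s.

(* symbol c0 phi belongs to the Gordon-Hedenmalm class with c0 >= 1; the values
   of phi outside half_plane 0 are irrelevant. *)
Definition class_G_ge1 (c0 : nat) (phi : R[i] -> R[i]) : Prop :=
  [/\ (1 <= c0)%N,
      exists c : nat -> R[i], forall eps : R, 0 < eps ->
        {uniform half_plane eps,
          (fun N => dirichlet_psum positive_integers c N) @ \oo --> phi} &
      phi @` half_plane 0 `<=` half_plane 0 \/
      exists tau : R, forall s, half_plane 0 s -> phi s = tau *i].

(* T is the composition operator on the space H^2 of ordinary Dirichlet series;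
   dirichlet_sum converges on half_plane (1/2) for square-summable
   coefficients, and symbol c0 phi maps half_plane (1/2) to itself. *)
Definition composition_operator_H2 (c0 : nat) (phi : R[i] -> R[i])
    (T : {linear l2 R -> l2 R}) : Prop :=
  continuous T /\
  forall (f : l2 R) s, half_plane (1 / 2) s ->
    dirichlet_sum positive_integers (T f) s =
    dirichlet_sum positive_integers f (symbol c0 phi s).

(* T is the composition operator on the generalized Dirichlet series with
   frequencies lam: it maps lam_n ^ (- s) to the formal product of
   (lam_n ^ c0) ^ (- s) with the ordinary Dirichlet series, of coefficients b,
   of the function lam_n ^ (- phi). These conditions determine T on the finite
   sums by linearity, hence everywhere by continuity. *)
Definition composition_operator_H2Lambda lam (c0 : nat) (phi : R[i] -> R[i])
    (T : {linear l2 R -> l2 R}) : Prop :=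
  continuous T /\
  forall n, exists b : l2 R,
    [/\ forall s, half_plane (1 / 2) s ->
          dirichlet_sum positive_integers b s = cpow (lam n) (- phi s),
        forall m k, lam k = lam n ^+ c0 * positive_integers m ->
          T (l2_delta R n) k = b m &
        forall k, (forall m, lam k <> lam n ^+ c0 * positive_integers m) ->
          T (l2_delta R n) k = 0].

Definition compact_on_H2 (c0 : nat) (phi : R[i] -> R[i]) : Prop :=
  exists T : {linear l2 R -> l2 R},
    composition_operator_H2 c0 phi T /\ compact_operator T.

Definition compact_on_H2Lambda lam (c0 : nat) (phi : R[i] -> R[i]) : Prop :=
  exists T : {linear l2 R -> l2 R},
    composition_operator_H2Lambda lam c0 phi T /\ compact_operator T.

End Dirichlet.

(* Main.v *)
Require Import Defs.
From HB Require Import structures.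
From mathcomp Require Import all_boot all_order all_algebra.
From mathcomp Require Import all_classical all_reals all_analysis.
From mathcomp Require Import complex ring lra zify.

Set Implicit Arguments.
Unset Strict Implicit.
Unset Printing Implicit Defensive.

Import Order.TTheory GRing.Theory Num.Theory.
Import numFieldNormedType.Exports.
Import ComplexField.Normc.

Local Open Scope classical_set_scope.
Local Open Scope ring_scope.
Local Open Scope complex_scope.

Local Notation Re := complex.Re.
Local Notation Im := complex.Im.

(* The generalized integers split into classes x * N, with x a product of the
   q_n that are not primes and N a positive integer, and the operator maps the
   class of x into the class of x ^ c0. Put n0 = floor x. Up to the isometries
   of multiplication by x ^ (- c0 s) and n0 ^ (- c0 s), its restriction to the
   class of x sends f to (x / n0) ^ (- phi) * C_psi (n0 ^ (- s) * f), and
   multiplication by (x / n0) ^ (- phi) is a contraction, as Re phi >= 0 and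
   x >= n0. A compact C_psi that is lower triangular is uniformly small on the
   series supported on large indices; as x < 2 n0, the same then holds for all
   the classes at once, whence compactness.

   The contraction property reduces to Dirichlet polynomials F, for which
   ||F f|| <= sup |F| ||f|| follows from comparing the discrete means
   (1/K) sum_(k < K) |F f|^2(sigma + i k h) and
   (1/K) sum_(k < K) |f|^2(sigma + i k h) as K tends to infinity. *)

(** The integer [n0] takes the place of [x] because the hypothesis speaks of ordinary series only.
    What matters is uniformity: there can be infinitely many classes, so compactness on each class
    separately would not suffice, whereas the loss in passing from [lam n = x * N n] to the integer
    [n0 * N n] is a factor 2 whatever the class. The classes can be estimated one by one because,
    [c0] being positive, [x ^ c0] determines [x], so that the images of distinct classes have
    disjoint supports. A second difficulty is that [lam n ^ (- phi)] is given by its values on Re s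
    > 0, whereas the operators are described by coefficients. Every such function is therefore
    handled as a limit of Dirichlet polynomials, uniform on each half-plane Re s > eps, and its
    coefficients as the limits of theirs. The exponential enters this class through the powers (1 +
    z / n) ^ n. The operator itself is built from its matrix, which is lower triangular: each
    coefficient of an image is a finite sum, and all estimates can be made on truncations. *)

(** * Modulus of complex numbers *)

Section ComplexNorm.
Variable R : realType.
Implicit Types z w : R[i].

Lemma normc_ge0 z : 0 <= normc z.
Proof. by case: z => x y; exact: sqrtr_ge0. Qed.

Lemma normcX z n : normc (z ^+ n) = normc z ^+ n.
Proof. by elim: n => [|n IH]; rewrite ?expr0 ?normc1// !exprS normcM IH. Qed.

Lemma normc_sum (I : Type) (r : seq I) (P : pred I) (F : I -> R[i]) :
  normc (\sum_(i <- r | P i) F i) <= \sum_(i <- r | P i) normc (F i).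
Proof.
elim/big_ind2 : _ => [|x1 x2 y1 y2 h1 h2|//]; first by rewrite normc0.
by rewrite (le_trans (le_normcD _ _))// lerD.
Qed.

Lemma sqr_normc_conj z : ((normc z ^+ 2)%:C : R[i]) = z * z^*%C.
Proof. by rewrite -sqr_normc rmorphXn. Qed.

Lemma sqr_normcE z : normc z ^+ 2 = Re z ^+ 2 + Im z ^+ 2.
Proof. by case: z => x y; rewrite sqr_sqrtr// addr_ge0 ?sqr_ge0. Qed.

Lemma normc_conj z : normc z^*%C = normc z.
Proof. by case: z => x y /=; rewrite sqrrN. Qed.

Lemma conjcX z n : (z ^+ n)^*%C = z^*%C ^+ n.
Proof. exact: rmorphXn. Qed.

Lemma conjcM z w : (z * w)^*%C = z^*%C * w^*%C.
Proof. exact: rmorphM. Qed.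

Lemma normcR (x : R) : normc x%:C = `|x|.
Proof. by rewrite /= expr0n addr0 sqrtr_sqr. Qed.

Lemma sqr_normcD z w :
  normc (z + w) ^+ 2 = normc z ^+ 2 + normc w ^+ 2 + 2 * Re (z * w^*%C).
Proof. by rewrite !sqr_normcE; case: z w => a b [c d] /=; ring. Qed.

Lemma le_Re_normc z : `|Re z| <= normc z.
Proof.
case: z => x y /=; rewrite -sqrtr_sqr ler_wsqrtr//.
by rewrite lerDl sqr_ge0.
Qed.

Lemma le_Im_normc z : `|Im z| <= normc z.
Proof.
case: z => x y /=; rewrite -sqrtr_sqr ler_wsqrtr//.
by rewrite lerDr sqr_ge0.
Qed.

Lemma le_normc_ReIm z : normc z <= `|Re z| + `|Im z|.
Proof.
rewrite {1}(complexE z) (le_trans (le_normcD _ _))// normcM !normcR.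
by rewrite /= expr0n /= add0r expr1n sqrtr1 mul1r.
Qed.

Lemma Re_sum (I : Type) (r : seq I) (P : pred I) (F : I -> R[i]) :
  Re (\sum_(i <- r | P i) F i) = \sum_(i <- r | P i) Re (F i).
Proof. by elim/big_rec2 : _ => [//|i x y _ <-]; rewrite raddfD. Qed.

End ComplexNorm.

(** * Mean squares of exponential sums at integer times *)

Section Parseval.
Variable R : realType.
Implicit Types (z c : nat -> R[i]) (w : R[i]) (r : seq nat).

Lemma geometric_sum_bounded w : normc w = 1 -> w != 1 ->
  exists B, forall K, normc (\sum_(k < K) w ^+ k) <= B.
Proof.
move=> w1 wN1; have d0 : 0 < normc (w - 1).
  rewrite lt_neqAle normc_ge0 andbT eq_sym.
  by apply: contra_neq wN1 => /eq0_normc/eqP; rewrite subr_eq0 => /eqP.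
exists (2 / normc (w - 1)) => K; rewrite ler_pdivlMr// mulrC -normcM -subrX1.
by rewrite (le_trans (le_normcD _ _))// normcN normcX w1 expr1n normc1.
Qed.

(** Each [c n] contributes a geometric sum whose ratio, [z n] times the conjugate of [w], is
    unimodular and different from 1. *)
Lemma trig_cross_bounded r z c w : {in r, forall n, normc (z n) = 1} ->
    {in r, forall n, z n != w} -> normc w = 1 ->
  exists B, forall K,
    normc (\sum_(k < K) (\sum_(n <- r) c n * z n ^+ k) * (w ^+ k)^*%C) <= B.
Proof.
elim: r => [|n r IH] z1 zw w1.
  by exists 0 => K; rewrite big1 ?normc0// => k _; rewrite big_nil mul0r.
have [||//|B hB] := IH; [by move=> m mr; apply: z1; rewrite inE mr orbT
  |by move=> m mr; apply: zw; rewrite inE mr orbT|].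
have ww : w * w^*%C = 1 by rewrite -sqr_normc_conj w1 expr1n.
have [||B' hB'] := @geometric_sum_bounded (z n * w^*%C).
- by rewrite normcM normc_conj w1 mulr1 z1// mem_head.
- apply: contra_neq (zw n (mem_head _ _)) => zw1.
  by rewrite -[LHS]mulr1 -ww mulrCA zw1 mulr1.
exists (normc (c n) * B' + B) => K.
under eq_bigr do rewrite big_cons mulrDl -mulrA conjcX -exprMn.
rewrite big_split/= -mulr_sumr (le_trans (le_normcD _ _))//.
rewrite normcM lerD ?ler_wpM2l ?normc_ge0 ?hB'//.
under eq_bigr do rewrite -conjcX.
exact: hB.
Qed.

(** The diagonal terms of the expanded square give exactly [K] times the sum of squares, and the
    cross terms between distinct nodes stay bounded in [K]. Nodes are added one at a time, each with
    its cross terms against the rest of the list. *)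
Lemma parseval_bounded r z c : uniq r -> {in r, forall n, normc (z n) = 1} ->
    {in r &, injective z} ->
  exists B, forall K,
    `|\sum_(k < K) normc (\sum_(n <- r) c n * z n ^+ k) ^+ 2
      - K%:R * \sum_(n <- r) normc (c n) ^+ 2| <= B.
Proof.
elim: r => [|n r IH] /= ur z1 zI.
  exists 0 => K; rewrite big_nil mulr0 subr0 big1 ?normr0// => k _.
  by rewrite big_nil normc0 expr0n.
case/andP: ur => nr ur.
have [//|||B hB] := IH.
- by move=> m mr; apply: z1; rewrite inE mr orbT.
- by move=> m m' mr mr'; apply: zI; rewrite inE ?mr ?mr' orbT.
have [|||B' hB'] := @trig_cross_bounded r z c (z n).
- by move=> m mr; apply: z1; rewrite inE mr orbT.
- move=> m mr; apply: contraNneq nr => /zI <-//; rewrite ?mem_head//.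
  by rewrite inE mr orbT.
- by rewrite z1// mem_head.
exists (B + 2 * (normc (c n) * B')) => K.
set X := \sum_(k < K) _.
have -> : X = \sum_(k < K) normc (\sum_(m <- r) c m * z m ^+ k) ^+ 2
    + K%:R * normc (c n) ^+ 2 + 2 * Re ((c n)^*%C * \sum_(k < K)
        (\sum_(m <- r) c m * z m ^+ k) * (z n ^+ k)^*%C).
  rewrite mulr_sumr Re_sum mulr_sumr mulr_natl -[K in _ *+ K]card_ord.
  rewrite -sumr_const -!big_split/=; apply: eq_bigr => k _.
  rewrite big_cons [c n * _ + _]addrC sqr_normcD normcM normcX z1 ?mem_head//.
  by rewrite expr1n mulr1 conjcM mulrCA.
rewrite big_cons mulrDr.
set Y := \sum_(k < K) normc _ ^+ 2; set S := \sum_(m <- r) normc _ ^+ 2.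
set W := Re _; rewrite [X in `|X|](_ : _ = (Y - K%:R * S) + 2 * W); last ring.
rewrite (le_trans (ler_normD _ _))// lerD ?hB// normrM ger0_norm// ler_wpM2l//.
rewrite (le_trans (le_Re_normc _))// normcM normc_conj ler_wpM2l ?normc_ge0//.
Qed.

End Parseval.

(** * Complex exponential and powers of positive reals *)

Section ComplexExp.
Variable R : realType.
Implicit Types (z w s : R[i]) (x y t : R).

Lemma expCD z w : expC (z + w) = expC z * expC w.
Proof.
case: z w => a b [c d]; rewrite /expC /= expRD cosD sinD.
by apply/eqP; rewrite eq_complex /=; apply/andP; split; apply/eqP; ring.
Qed.

Lemma expC0 : expC 0 = 1 :> R[i].
Proof. by rewrite /expC /= expR0 cos0 sin0 mul1r. Qed.

Lemma normc_expC z : normc (expC z) = expR (Re z).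
Proof.
rewrite normcM normcR ger0_norm ?expR_ge0//= cos2Dsin2 sqrtr1 mulr1//.
Qed.

Lemma expC_nat z n : expC (n%:R * z) = expC z ^+ n.
Proof.
elim: n => [|n IH]; first by rewrite mul0r expC0.
by rewrite -natr1 mulrDl mul1r expCD IH exprSr.
Qed.

Lemma cpowD x z w : cpow x (z + w) = cpow x z * cpow x w.
Proof. by rewrite /cpow mulrDl expCD. Qed.

Lemma cpowM x y s : 0 < x -> 0 < y -> cpow (x * y) s = cpow x s * cpow y s.
Proof. by move=> x0 y0; rewrite /cpow lnM// rmorphD mulrDr expCD. Qed.

Lemma cpow_nat x s n : cpow x (n%:R * s) = cpow x s ^+ n.
Proof. by rewrite /cpow -mulrA expC_nat. Qed.

Lemma cpowX x s n : 0 < x -> cpow (x ^+ n) s = cpow x s ^+ n.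
Proof.
move=> x0; rewrite /cpow lnXn// -mulr_natl rmorphM rmorph_nat mulrCA.
exact: expC_nat.
Qed.

Lemma cpow1 s : cpow 1 s = 1 :> R[i].
Proof. by rewrite /cpow ln1 mulr0 expC0. Qed.

Lemma normc_cpow x s : normc (cpow x s) = expR (Re s * ln x).
Proof. by rewrite normc_expC; case: s => a b /=; rewrite mulr0 subr0. Qed.

Lemma cos_eq1 t : `|t| < pi -> cos t = 1 -> t = 0.
Proof.
move=> tpi ct; apply/eqP; rewrite -normr_eq0; apply/eqP.
apply: (@cos_inj R); rewrite ?in_itv/= ?normr_ge0 ?lexx ?pi_ge0 ?ltW//.
by rewrite cos0; have [t0|t0] := ger0P t; rewrite ?cosN ct.
Qed.

Lemma expC_imaginary_inj x y : `|x - y| < pi -> expC (x *i) = expC (y *i) ->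
  x = y.
Proof.
move=> xy h; apply/eqP; rewrite -subr_eq0; apply/eqP/cos_eq1 => //.
have e : expC ((x - y) *i) = 1.
  have -> : (x - y) *i = x *i + (- y) *i.
    by apply/eqP; rewrite eq_complex /= addr0 !eqxx.
  rewrite expCD h -expCD -[RHS]expC0; congr expC.
  by apply/eqP; rewrite eq_complex /= addr0 subrr !eqxx.
by move: e; rewrite /expC /= expR0 mul1r => -[].
Qed.

End ComplexExp.

(** * Dirichlet polynomials and their contraction estimate *)

Section DirichletPolynomials.
Variable R : realType.
Implicit Types (a b f : nat -> R[i]) (F G : R[i] -> R[i]) (s z : R[i]).

(* Coefficients are indexed by positive integers here: [a 0] is junk. *)
Definition dpsum a N s : R[i] := \sum_(1 <= n < N) a n * cpow n%:R (- s).

(** Asking for every N >= D lets two polynomials be written with a common length; [dpolyI] shows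
    that a single length is enough. *)
Definition dpoly a F : Prop :=
  exists D, (forall n, (D <= n)%N -> a n = 0) /\
            forall N s, (D <= N)%N -> F s = dpsum a N s.

(** Dirichlet convolution, the coefficients of a product. Both factors range over a box rather than
    over the divisors of [n], so that the box can be enlarged ([dconv_widen]) and the sums
    exchanged. *)
Definition dconv a b n : R[i] :=
  \sum_(1 <= d < n.+1) \sum_(1 <= e < n.+1 | (d * e == n)%N) a d * b e.

Lemma dconv_widen a b n N : (0 < n < N)%N ->
  dconv a b n = \sum_(1 <= d < N) \sum_(1 <= e < N | (d * e == n)%N) a d * b e.
Proof.
move=> /andP[n0 nN]; rewrite /dconv (big_nat_widen _ _ _ _ _ nN) big_mkcond/=.
apply: eq_big_nat => d /andP[d0 dN].
rewrite (big_nat_widen _ _ _ _ _ nN); case: ltnP => [dn|nd].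
  rewrite big_nat_cond [RHS]big_nat_cond; apply: eq_bigl => e.
  case: eqP => [den|_]; last by rewrite !andbF.
  have en : (e < n.+1)%N by rewrite ltnS -den leq_pmull.
  by rewrite en (leq_trans en nN).
rewrite big_nat_cond big1// => e /andP[/andP[e0 _] /eqP den]; move: nd.
by rewrite -den ltnNge leq_pmulr.
Qed.

Lemma eq_dconv a a' b b' n :
    (forall k, (0 < k <= n)%N -> a k = a' k /\ b k = b' k) ->
  dconv a b n = dconv a' b' n.
Proof.
move=> h; rewrite /dconv; apply: eq_big_nat => d dn.
rewrite big_nat_cond [RHS]big_nat_cond; apply: eq_bigr => e /andP[en _].
by have [-> _] := h _ dn; have [_ ->] := h _ en.
Qed.

Lemma dpsum_widen a D N s : (forall n, (D <= n)%N -> a n = 0) -> (D <= N)%N ->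
  dpsum a N s = dpsum a D s.
Proof.
move=> aD DN; rewrite /dpsum (big_nat_widen _ _ _ _ _ DN) big_mkcond [RHS]big_mkcond/=.
rewrite [RHS]big_mkcond/=; apply: eq_bigr => n _.
by case: ltnP => // /aD ->; rewrite mul0r.
Qed.

Lemma dpolyI a D F : (forall n, (D <= n)%N -> a n = 0) ->
  (forall s, F s = dpsum a D s) -> dpoly a F.
Proof.
by move=> aD FD; exists D; split=> // N s DN; rewrite FD (dpsum_widen _ aD).
Qed.

Lemma dpolyM a b F G : dpoly a F -> dpoly b G ->
  dpoly (dconv a b) (fun s => F s * G s).
Proof.
(* Nonzero terms have index below D * E; the summand D + E makes the length admissible for both
   factors even when D or E is 0. *)
move=> [D [aD FD]] [E [bE GE]]; apply: (@dpolyI _ (D * E + D + E)%N).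
  move=> n nDE; rewrite /dconv big1// => d _; rewrite big1// => e /eqP den.
  have [/aD ->|dD] := leqP D d; first by rewrite mul0r.
  have [/bE ->|eE] := leqP E e; first by rewrite mulr0.
  by exfalso; have := leq_mul (ltnW dD) (ltnW eE); lia.
move=> s; set N := (_ + _)%N; rewrite (FD N) ?(GE N); try by rewrite /N; lia.
rewrite /dpsum.
transitivity (\sum_(1 <= n < N) \sum_(1 <= d < N) \sum_(1 <= e < N | (d * e == n)%N)
    a d * b e * cpow n%:R (- s)); last first.
  apply: eq_big_nat => n nN; rewrite (dconv_widen _ _ nN) mulr_suml.
  by apply: eq_bigr => d _; rewrite mulr_suml.
rewrite exchange_big/= mulr_suml; apply: eq_big_nat => d /andP[d0 dN].
rewrite (exchange_big_dep xpredT)//= mulr_sumr;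
  apply: eq_big_nat => e /andP[e0 eN].
under eq_bigl do rewrite eq_sym.
rewrite big_nat1_eq muln_gt0 d0 e0/=; case: ltnP => [|deN].
  by rewrite natrM cpowM ?ltr0n// mulrACA.
have [/aD ->|dD] := leqP D d; first by rewrite !mul0r.
have [/bE ->|eE] := leqP E e; first by rewrite mul0r mulr0.
by exfalso; have := leq_mul (ltnW dD) (ltnW eE); rewrite /N in deN; lia.
Qed.

Lemma dpolyD a b F G : dpoly a F -> dpoly b G ->
  dpoly (fun n => a n + b n) (fun s => F s + G s).
Proof.
move=> [D [aD FD]] [E [bE GE]]; apply: (@dpolyI _ (D + E)%N).
  by move=> n nDE; rewrite aD ?bE ?addr0//; lia.
move=> s; rewrite (FD (D + E)%N) ?leq_addr// (GE (D + E)%N) ?leq_addl//.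
by rewrite /dpsum -big_split/=; apply: eq_bigr => n _; rewrite mulrDl.
Qed.

Lemma dpolyZ c a F : dpoly a F -> dpoly (fun n => c * a n) (fun s => c * F s).
Proof.
move=> [D [aD FD]]; apply: (@dpolyI _ D).
  by move=> n nDE; rewrite aD ?mulr0.
move=> s; rewrite (FD D)// /dpsum mulr_sumr.
by apply: eq_bigr => n _; rewrite mulrA.
Qed.

Definition ddelta k (n : nat) : R[i] := (n == k)%:R.

Lemma dpoly_delta k : (0 < k)%N -> dpoly (ddelta k) (fun s => cpow k%:R (- s)).
Proof.
move=> k0; apply: (@dpolyI _ k.+1).
  by move=> n kn; rewrite /ddelta gtn_eqF.
move=> s; rewrite /dpsum.
transitivity (\sum_(1 <= n < k.+1 | n == k) cpow n%:R (- s) : R[i]).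
  by rewrite big_nat1_eq k0 ltnSn.
by rewrite big_mkcond; apply: eq_bigr => n _; rewrite /ddelta; case: eqP => _;
  rewrite ?mul1r ?mul0r.
Qed.

Lemma dconv_delta k a n : (0 < k)%N -> (0 < n)%N ->
  dconv (ddelta k) a n = if (k %| n)%N then a (n %/ k)%N else 0.
Proof.
move=> k0 n0; rewrite (@dconv_widen _ _ _ (n + k).+1) ?n0 ?leq_addr//.
transitivity (\sum_(1 <= d < (n + k).+1 | d == k)
    \sum_(1 <= e < (n + k).+1 | (d * e == n)%N) a e).
  rewrite [RHS]big_mkcond; apply: eq_bigr => d _; rewrite /ddelta.
  by case: eqP => _; [|rewrite big1//]; [apply: eq_bigr|] => e _;
    rewrite ?mul1r ?mul0r.
rewrite big_nat1_eq k0 ltnS leq_addl/=; case: ifPn => kn.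
  transitivity (\sum_(1 <= e < (n + k).+1 | e == (n %/ k)%N) a e).
    by apply: eq_bigl => e; rewrite -[RHS](eqn_pmul2l k0) [(k * (n %/ k))%N]mulnC divnK.
  rewrite big_nat1_eq divn_gt0// dvdn_leq//= ltnS (leq_trans (leq_div _ _))//.
  exact: leq_addr.
rewrite big1// => e /eqP ken; move: kn; by rewrite -ken dvdn_mulr.
Qed.

Lemma dpoly_bounded a F : dpoly a F ->
  exists2 B, 0 <= B & forall s, 0 < Re s -> normc (F s) <= B.
Proof.
move=> [D [_ FD]]; exists (\sum_(1 <= n < D) normc (a n)).
  by apply: sumr_ge0 => n _; exact: normc_ge0.
move=> s s0; rewrite (FD D)// (le_trans (normc_sum _ _ _))//.
rewrite big_nat_cond [leRHS]big_nat_cond;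
  apply: ler_sum => n /andP[/andP[n1 _] _].
rewrite normcM ler_piMr ?normc_ge0// normc_cpow -[leRHS]expR0 ler_expR.
rewrite raddfN mulNr oppr_le0 mulr_ge0 ?(ltW s0)// ln_ge0//.
by rewrite ler1n.
Qed.

(** This is n ^ (- sigma), the modulus of n ^ (- s) on the line Re s = sigma. *)
Definition weight (sigma : R) n : R := expR (- sigma * ln n%:R).

(** On the sampling points [s k] the pointwise bound by [B] is available, and the sampled sums of
    squares are [K] times the two sides up to errors that do not depend on [K]. *)
Lemma dpoly_contraction a F (B eps sigma : R) f M : dpoly a F -> 0 <= B ->
    (forall s, eps < Re s -> normc (F s) <= B) -> eps < sigma ->
  \sum_(1 <= n < M) (normc (dconv a f n) * weight sigma n) ^+ 2 <=
  B ^+ 2 * \sum_(1 <= n < M) (normc (f n) * weight sigma n) ^+ 2.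
Proof.
move=> aF B0 FB es.
(* Cutting [f] at [M] makes it a polynomial and leaves the coefficients of the product below [M]
   unchanged, since these only read smaller or equal indices. *)
pose g n := if (n < M)%N then f n else 0.
have gG : dpoly g (dpsum g M).
  by apply: (@dpolyI _ M) => // n nM; rewrite /g ltnNge nM.
have [D [uD GD]] := dpolyM aF gG; have [E [gE HE]] := gG.
(* The step [h] is so small that h * ln n lies in [0, 1) for 1 <= n < N. The phases of the numbers
   [z n], which are n ^ (- i h), then differ by less than pi, and the nodes are distinct. *)
pose N := (D + E + M)%N; pose h : R := (1 + ln N.+1%:R)^-1.
have lnN0 : 0 <= ln (N.+1%:R : R) by rewrite ln_ge0// ler1n.
have h0 : 0 < h by rewrite invr_gt0 ltr_pwDl.
pose z n := expC ((- (h * ln n%:R)) *i) : R[i].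
pose s k : R[i] := sigma%:C + (k%:R * h) *i.
have zs n k : cpow n%:R (- s k) = (weight sigma n)%:C * z n ^+ k.
  rewrite -expC_nat /cpow (_ : - s k * _ = (- sigma * ln n%:R)%:C
    + k%:R * (- (h * ln n%:R)) *i); last first.
    rewrite /s -[k%:R in RHS](rmorph_nat (real_complex R)).
    by apply/eqP; rewrite eq_complex /=; apply/andP; split; apply/eqP; ring.
  rewrite expCD; congr (_ * _).
  by rewrite /expC /= cos0 sin0 mulr1.
have z1 : {in index_iota 1 N, forall n, normc (z n) = 1}.
  by move=> n _; rewrite normc_expC /= expR0.
have zI : {in index_iota 1 N &, injective z}.
  move=> m n; rewrite !mem_index_iota => /andP[m1 mN] /andP[n1 nN] zmn.
  have ln01 k : (1 <= k)%N -> (k < N)%N -> 0 <= h * ln (k%:R : R) < 1.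
    move=> k1 kN; have lk : 0 <= ln (k%:R : R) by rewrite ln_ge0// ler1n.
    apply/andP; split; first exact: mulr_ge0 (ltW h0) lk.
    rewrite mulrC ltr_pdivrMr ?mul1r ?ltr_pwDl//.
    by rewrite ler_ln ?posrE ?ltr0n// ler_nat; lia.
  have : - (h * ln (m%:R : R)) = - (h * ln (n%:R : R)).
    apply: expC_imaginary_inj => //.
    have := ln01 _ m1 mN; have := ln01 _ n1 nN; have := pi_ge2 R.
    by move: (h * ln _) (h * ln _) => x y ? ? ?; rewrite ltr_norml; lra.
  move/oppr_inj/(mulfI (lt0r_neq0 h0)) => /ln_inj;
    rewrite !posrE !ltr0n => lnmn.
  by apply/eqP; rewrite -(eqr_nat R); apply/eqP/lnmn.
have dpE a' G k : (forall s, G s = dpsum a' N s) -> G (s k) =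
    \sum_(n <- index_iota 1 N) (a' n * (weight sigma n)%:C) * z n ^+ k.
  by move=> ->; apply: eq_bigr => n _; rewrite zs mulrA.
have [B1 hB1] := parseval_bounded (fun n => dconv a g n * (weight sigma n)%:C)
  (iota_uniq _ _) z1 zI.
have [B2 hB2] := parseval_bounded (fun n => g n * (weight sigma n)%:C)
  (iota_uniq _ _) z1 zI.
have wE (c : nat -> R[i]) : \sum_(n <- index_iota 1 N) normc (c n * (weight sigma n)%:C) ^+ 2
    = \sum_(1 <= n < N) (normc (c n) * weight sigma n) ^+ 2.
  by apply: eq_bigr => n _; rewrite normcM normcR ger0_norm ?expR_ge0.
have ineq K : K%:R * (\sum_(1 <= n < N) (normc (dconv a g n) * weight sigma n) ^+ 2
    - B ^+ 2 * \sum_(1 <= n < N) (normc (g n) * weight sigma n) ^+ 2) <=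
    B1 + B ^+ 2 * B2.
  have := hB1 K; have := hB2 K; rewrite !wE !ler_norml.
  have -> : \sum_(k < K) normc (\sum_(n <- index_iota 1 N)
      g n * (weight sigma n)%:C * z n ^+ k) ^+ 2 =
      \sum_(k < K) normc (dpsum g M (s k)) ^+ 2.
    apply: eq_bigr => k _; rewrite (dpE g) // => s'.
    by apply: HE; rewrite /N; lia.
  have -> : \sum_(k < K) normc (\sum_(n <- index_iota 1 N)
      dconv a g n * (weight sigma n)%:C * z n ^+ k) ^+ 2 =
      \sum_(k < K) normc (F (s k) * dpsum g M (s k)) ^+ 2.
    apply: eq_bigr => k _; rewrite (dpE (dconv a g) (fun s => F s * dpsum g M s)) // => s'.
    by apply: GD; rewrite /N; lia.
  set V := \sum_(1 <= n < N) _; set U := \sum_(1 <= n < N) _.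
  set P := \sum_(k < K) _; set Q := \sum_(k < K) _ => /andP[_ hP] /andP[hQ _].
  have PQ : Q <= B ^+ 2 * P.
    rewrite mulr_sumr; apply: ler_sum => k _; rewrite normcM exprMn.
    rewrite ler_wpM2r ?sqr_ge0// ler_sqr ?nnegrE ?normc_ge0// FB//.
    by rewrite /s /= addr0.
  have := ler_wpM2l (sqr_ge0 B) hP; move: hQ PQ.
  rewrite !mulrBr; set B' := B ^+ 2; lra.
have gM n : (1 <= n < M)%N -> dconv a g n = dconv a f n.
  move=> /andP[_ nM]; apply: eq_dconv => k /andP[k0 kn]; split=> //.
  by rewrite /g (leq_ltn_trans kn).
have -> : \sum_(1 <= n < M) (normc (dconv a f n) * weight sigma n) ^+ 2 =
    \sum_(1 <= n < M) (normc (dconv a g n) * weight sigma n) ^+ 2.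
  by apply: eq_big_nat => n nM; rewrite gM.
have MN : (M <= N)%N by rewrite /N; lia.
have -> : \sum_(1 <= n < M) (normc (f n) * weight sigma n) ^+ 2 =
    \sum_(1 <= n < N) (normc (g n) * weight sigma n) ^+ 2.
  rewrite (big_nat_widen _ _ _ _ _ MN) big_mkcond; apply: eq_bigr => n _ /=.
  by rewrite /g; case: ifP => // _; rewrite normc0 mul0r expr0n.
apply: (@le_trans _ _ (\sum_(1 <= n < N) (normc (dconv a g n) * weight sigma n) ^+ 2)).
  rewrite (big_nat_widen _ _ _ _ _ MN) big_mkcond; apply: ler_sum => n _ /=.
  by case: ifP => // _; rewrite sqr_ge0.
(* A positive difference would make the left side of [ineq] grow linearly in [K], against a fixed
   bound. *)
rewrite leNgt -subr_gt0; apply/negP => d0.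
set d := _ - _ in d0 ineq; have := ineq (Num.truncn ((B1 + B ^+ 2 * B2) / d)).+1.
rewrite leNgt -ltr_pdivrMr// => /negP; apply.
exact: truncnS_gt.
Qed.

End DirichletPolynomials.

(** * Coefficients of uniform limits of Dirichlet polynomials *)

Section Approximation.
Variable R : realType.
Implicit Types (a b f : nat -> R[i]) (F G g h : R[i] -> R[i]) (s z : R[i]).
Implicit Types (eps eta : R).

Lemma dconvC a b n : dconv a b n = dconv b a n.
Proof.
rewrite /dconv (exchange_big_dep xpredT)//=; apply: eq_bigr => d _.
by apply: eq_big => [e|e _]; rewrite 1?mulnC 1?mulrC.
Qed.

Lemma dconv1 a n : (0 < n)%N -> dconv (ddelta R 1) a n = a n.
Proof. by move=> n0; rewrite dconv_delta// dvd1n divn1. Qed.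

(** The contraction estimate applied to the constant series 1. *)
Lemma dpoly_sum_le a F B eps sigma M : dpoly a F -> 0 <= B -> eps < sigma ->
    (forall s, eps < Re s -> normc (F s) <= B) ->
  \sum_(1 <= n < M) (normc (a n) * weight sigma n) ^+ 2 <= B ^+ 2.
Proof.
move=> aF B0 e1 FB; have := dpoly_contraction (ddelta R 1) M aF B0 FB e1.
have -> : \sum_(1 <= n < M) (normc (dconv a (ddelta R 1) n) * weight sigma n) ^+ 2
    = \sum_(1 <= n < M) (normc (a n) * weight sigma n) ^+ 2.
  by apply: eq_big_nat => n /andP[n0 _]; rewrite dconvC dconv1.
move=> /le_trans; apply; rewrite ler_piMr ?sqr_ge0//.
have [M1|M1] := leqP M 1; first by rewrite big_geq.
rewrite big_ltn// big_nat_cond big1.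
  by rewrite addr0 /ddelta eqxx normc1 /weight ln1 mulr0 expR0 mulr1 expr1n.
move=> k /andP[/andP[k2 _] _]; rewrite /ddelta gtn_eqF//.
by rewrite normc0 mul0r expr0n.
Qed.

(** One term of [dpoly_sum_le] at sigma = 1; the factor [n] undoes the weight n ^ (- 1). *)
Lemma dpoly_coef_le a F B eps n : dpoly a F -> 0 <= B -> eps < 1 ->
    (forall s, eps < Re s -> normc (F s) <= B) -> (0 < n)%N ->
  normc (a n) <= B * n%:R.
Proof.
move=> aF B0 e1 FB n0; have := dpoly_sum_le n.+1 aF B0 e1 FB.
rewrite big_nat_recr//= => h.
have : (normc (a n) * weight 1 n) ^+ 2 <= B ^+ 2.
  apply: le_trans h; rewrite lerDr; apply: sumr_ge0 => *; exact: sqr_ge0.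
rewrite ler_sqr ?nnegrE ?mulr_ge0 ?normc_ge0 ?expR_ge0//.
rewrite /weight mulN1r expRN lnK ?posrE ?ltr0n//.
by rewrite ler_pdivrMr ?ltr0n.
Qed.

(* The values of a function on the whole right half-plane determine the
   coefficients of its Dirichlet series, although the series itself need only
   converge for Re s > 1/2. *)
Definition has_dcoef a g : Prop := forall eps eta M, 0 < eps -> 0 < eta ->
  exists a' F, [/\ dpoly a' F,
    forall s, eps < Re s -> normc (F s - g s) <= eta &
    forall n, (0 < n < M)%N -> normc (a' n - a n) <= eta].

(** The polynomial may change with [eps] and [eta]; that a single coefficient sequence serves all of
    them is [uniform_dlimit_coef]. *)
Definition uniform_dlimit g : Prop := forall eps eta, 0 < eps -> 0 < eta ->
  exists a F, dpoly a F /\ forall s, eps < Re s -> normc (F s - g s) <= eta.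

Lemma has_dcoef_uniform_dlimit a g : has_dcoef a g -> uniform_dlimit g.
Proof. by move=> ag e t e0 t0; have [a' [F [? ? _]]] := ag e t 0%N e0 t0;
  exists a', F. Qed.

Lemma dpoly_has_dcoef a F : dpoly a F -> has_dcoef a F.
Proof.
move=> aF e t M e0 t0; exists a, F; split=> // *; rewrite subrr normc0 ltW//.
Qed.

Lemma normc_small_eq0 z (C : R) : (forall eta, 0 < eta ->
  normc z <= C * eta) -> z = 0.
Proof.
move=> h; apply/eq0_normc/eqP; rewrite eq_le normc_ge0 andbT leNgt.
apply/negP => z0; have C0 : 0 < `|C| + 1 by rewrite ltr_wpDl.
pose e := normc z / (`|C| + 1) / 2.
have e0 : 0 < e by rewrite !divr_gt0.
have ze : normc z = (`|C| + 1) * e * 2.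
  by rewrite /e; field; rewrite lt0r_neq0.
have := h e e0; rewrite {}ze.
have := ler_wpM2r (ltW e0) (ler_norm C);
  have := mulr_ge0 (normr_ge0 C) (ltW e0).
rewrite mulrDl; lra.
Qed.

Lemma distcC z w : normc (z - w) = normc (w - z).
Proof. by rewrite -normcN opprB. Qed.

Lemma distc_le x z w (t t' : R) : normc (z - x) <= t -> normc (w - x) <= t' ->
  normc (z - w) <= t + t'.
Proof.
move=> h h'; have -> : z - w = (z - x) + (x - w) by ring.
by apply: le_trans (le_normcD _ _) _; rewrite lerD// distcC.
Qed.

Lemma dpoly_coef_dist a b F G eps (t : R) n : dpoly a F -> dpoly b G ->
  eps < 1 -> 0 <= t ->
  (forall s, eps < Re s -> normc (F s - G s) <= t) -> (0 < n)%N ->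
  normc (a n - b n) <= t * n%:R.
Proof.
move=> aF bG e1 t0 FG n0; rewrite -mulN1r.
apply: (dpoly_coef_le (dpolyD aF (dpolyZ (-1) bG)) t0 e1 _ n0) => s es.
by rewrite mulN1r FG.
Qed.

(** Two approximants of [g] are close to each other on Re s > 1/2, hence so are their coefficients
    by [dpoly_coef_dist]; any abscissa below 1 would do. *)
Lemma has_dcoef_inj a b g n : has_dcoef a g -> has_dcoef b g -> (0 < n)%N ->
  a n = b n.
Proof.
move=> ag bg n0; apply/eqP; rewrite -subr_eq0; apply/eqP.
apply: (@normc_small_eq0 _ (2 + 2 * n%:R)) => t t0.
have h2 : 0 < 2^-1 :> R by rewrite invr_gt0.
have [a' [F [aF Fg aa']]] := ag _ _ n.+1 h2 t0.
have [b' [G [bG Gg bb']]] := bg _ _ n.+1 h2 t0.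
have h : normc (a' n - b' n) <= (t + t) * n%:R.
  apply: (@dpoly_coef_dist _ _ _ _ 2^-1 _ _ aF bG) => //; [lra|lra|].
  move=> s es; exact: (distc_le (Fg _ es) (Gg _ es)).
have := aa' n; rewrite n0 ltnSn => /(_ isT) h'.
have := bb' n; rewrite n0 ltnSn => /(_ isT) h''.
have -> : a n - b n = - (a' n - a n) + (a' n - b' n) + (b' n - b n) by ring.
have := le_normcD (- (a' n - a n) + (a' n - b' n)) (b' n - b n).
have := le_normcD (- (a' n - a n)) (a' n - b' n); rewrite normcN; lra.
Qed.

(** The intervals [u i - e i, u i + e i] meet pairwise, so the supremum of their left ends lies in
    all of them. This gives the limit of a Cauchy sequence together with its rate. *)
Lemma sup_between (u e : nat -> R) : (forall i j, u j - e j <= u i + e i) ->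
  exists l, forall i, `|u i - l| <= e i.
Proof.
move=> h; pose S := [set u j - e j | j in setT].
have ub i : ubound S (u i + e i) by move=> _ [j _ <-].
exists (sup S) => i; rewrite ler_norml.
have h1 : sup S <= u i + e i by apply: ge_sup => //;
  exists (u 0%N - e 0%N), 0%N.
have h2 : u i - e i <= sup S.
  have hS : has_ubound S by exists (u 0%N + e 0%N).
  by apply: ub_le_sup hS _ _; exists i.
by apply/andP; split; lra.
Qed.

Lemma complex_cauchy (u : nat -> R[i]) (e : nat -> R) :
    (forall i j, normc (u i - u j) <= e i + e j) ->
  exists l, forall i, normc (u i - l) <= 2 * e i.
Proof.
move=> h.
have [|x hx] := @sup_between (fun i => Re (u i)) e.
  move=> i j; have := le_trans (le_Re_normc _) (h i j).
  by rewrite raddfB/= ler_norml => /andP[]; lra.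
have [|y hy] := @sup_between (fun i => Im (u i)) e.
  move=> i j; have := le_trans (le_Im_normc _) (h i j).
  by rewrite raddfB/= ler_norml => /andP[]; lra.
exists (x +i* y) => i; rewrite (le_trans (le_normc_ReIm _))//.
by rewrite !raddfB/= mulr2n mulrDl mul1r lerD.
Qed.

(** Two approximants are compared on the smaller of their half-planes; [dpoly_coef_dist] makes each
    coefficient a Cauchy sequence, with a rate that degrades only by the factor [n]. *)
Lemma uniform_dlimit_coef g : uniform_dlimit g -> exists a, has_dcoef a g.
Proof.
(* The shift by 2 keeps every [e j] below 1, as [dpoly_coef_dist] requires. *)
move=> ug; pose e j : R := j.+2%:R^-1.
have e0 j : 0 < e j by rewrite invr_gt0 ltr0n.
have ele i j : (i <= j)%N -> e j <= e i.
  by move=> ij; rewrite lef_pV2 ?posrE ?ltr0n// ler_nat.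
have e1 j : e j < 1 by rewrite invf_lt1 ?ltr0n// ltr1n.
have /choice [A hA] : forall j, exists aF : (nat -> R[i]) * (R[i] -> R[i]),
    dpoly aF.1 aF.2 /\ forall s, e j < Re s -> normc (aF.2 s - g s) <= e j.
  by move=> j; have [a [F h]] := ug _ _ (e0 j) (e0 j); exists (a, F).
have dist n i j : (0 < n)%N ->
    normc ((A i).1 n - (A j).1 n) <= (e i + e j) * n%:R.
  move=> n0; have [iF ig] := hA i; have [jF jg] := hA j.
  apply: (@dpoly_coef_dist _ _ _ _ (Num.max (e i) (e j)) _ _ iF jF) => //.
  - by rewrite gt_max !e1.
  - by rewrite addr_ge0 ?ltW.
  move=> s; rewrite gt_max => /andP[is_ js].
  exact: (distc_le (ig _ is_) (jg _ js)).
have reim n : exists l : R[i], (0 < n)%N ->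
    forall i, normc ((A i).1 n - l) <= 2 * (e i * n%:R).
  case: (posnP n) => [->|n0]; first by exists 0.
  have [|l hl] := @complex_cauchy (fun i => (A i).1 n) (fun i => e i * n%:R).
    by move=> i j; rewrite -mulrDl dist.
  by exists l.
have [a ha] := choice reim; exists a => eps eta M eps0 eta0.
(* One inequality e j * x <= 1 yields both e j <= eps and e j * (1 + 2 M) <= eta. *)
pose x : R := eps^-1 + (1 + 2 * M%:R) / eta.
have [j jx] : exists j, e j * x <= 1.
  exists (Num.truncn x); rewrite mulrC ler_pdivrMr ?ltr0n// mul1r ltW//.
  have x0 : 0 <= x by rewrite addr_ge0 ?invr_ge0 ?divr_ge0// ?ltW// ltr_wpDr ?mulr_ge0.
  have /andP[_ /lt_le_trans->//] := truncn_itv x0; by rewrite ler_nat.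
have [x1 x2] : e j * eps^-1 <= 1 /\ e j * ((1 + 2 * M%:R) / eta) <= 1.
  have y0 : 0 <= e j * eps^-1 by rewrite ltW// divr_gt0.
  have z0 : 0 <= e j * ((1 + 2 * M%:R) / eta).
    by rewrite ltW// mulr_gt0// divr_gt0// ltr_wpDr ?mulr_ge0.
  by move: jx; rewrite mulrDr; split; lra.
rewrite ler_pdivrMr ?mul1r// in x1.
rewrite mulrA ler_pdivrMr ?mul1r// in x2.
have [aF ag] := hA j; exists (A j).1, (A j).2; split=> //.
- move=> s es; have M0 : 0 <= e j * (2 * M%:R)
  by rewrite mulr_ge0 ?mulr_ge0// ltW.
  by apply: le_trans (ag s _) _; [exact: le_lt_trans es|lra].
- move=> n /andP[n0 nM]; apply: le_trans (ha n n0 j) _.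
  have : e j * n%:R <= e j * M%:R by rewrite ler_pM2l// ler_nat ltnW.
  by have := e0 j; lra.
Qed.

Lemma uniform_dlimit_bounded g eps : uniform_dlimit g -> 0 < eps ->
  exists2 B, 0 <= B & forall s, eps < Re s -> normc (g s) <= B.
Proof.
move=> ug e0; have [a [F [aF Fg]]] := ug _ _ e0 ltr01.
have [B B0 FB] := dpoly_bounded aF; exists (B + 1); first by rewrite addr_ge0.
move=> s es; have -> : g s = F s + - (F s - g s) by ring.
apply: le_trans (le_normcD _ _) _; rewrite normcN lerD ?Fg// FB//.
exact: lt_trans es.
Qed.

(** Termwise, a' b' - a b = a' (b' - b) + b (a' - a). Summing over the whole box overcounts, but
    gives constants that do not depend on [n]. *)
Lemma dconv_dist a b a' b' (t t' : R) M n : 0 <= t -> 0 <= t' ->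
  (forall k, (0 < k < M)%N -> normc (a' k - a k) <= t) ->
  (forall k, (0 < k < M)%N -> normc (b' k - b k) <= t') -> (0 < n < M)%N ->
  normc (dconv a' b' n - dconv a b n) <=
  (\sum_(1 <= d < M) \sum_(1 <= e < M) normc (a' d)) * t' +
  (\sum_(1 <= d < M) \sum_(1 <= e < M) normc (b e)) * t.
Proof.
move=> t0 t'0 ha hb nM; rewrite !(dconv_widen _ _ nM) !mulr_suml -sumrB -big_split/=.
apply: le_trans (normc_sum _ _ _) _.
apply: ler_sum_nat => d dM.
rewrite !mulr_suml -sumrB -big_split/=.
apply: le_trans (normc_sum _ _ _) _.
rewrite big_mkcond/=; apply: ler_sum_nat => e eM.
case: ifP => _; last by rewrite addr_ge0// mulr_ge0 ?normc_ge0.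
have -> : a' d * b' e - a d * b e = a' d * (b' e - b e) + b e * (a' d - a d)
  by ring.
apply: le_trans (le_normcD _ _) _; rewrite !normcM.
by rewrite lerD// ler_wpM2l ?normc_ge0// ?ha ?hb.
Qed.

(** The order of choices matters: the tolerance [t1] depends on [h] and [b] only, and [t2] is fixed
    once the approximant of [g] is known, since it involves the size of [F] and of [a']. *)
Lemma has_dcoefM a b g h : has_dcoef a g -> has_dcoef b h ->
  has_dcoef (dconv a b) (fun s => g s * h s).
Proof.
move=> ag bh eps eta M e0 t0.
have [Bh Bh0 hB] := uniform_dlimit_bounded (has_dcoef_uniform_dlimit bh) e0.
pose Cb : R := \sum_(1 <= d < M) \sum_(1 <= e < M) normc (b e).
have Cb0 : 0 <= Cb by do 2![apply: sumr_ge0 => ? _]; exact: normc_ge0.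
pose t1 := eta / 2 / (1 + Bh + Cb).
have t10 : 0 < t1 by rewrite !divr_gt0// ltr_wpDr// ltr_wpDr.
have [a' [F [aF Fg aa']]] := ag _ _ M e0 t10.
have [BF BF0 FB] := dpoly_bounded aF.
pose Ca : R := \sum_(1 <= d < M) \sum_(1 <= e < M) normc (a' d).
have Ca0 : 0 <= Ca by do 2![apply: sumr_ge0 => ? _]; exact: normc_ge0.
pose t2 := eta / 2 / (1 + BF + Ca).
have t20 : 0 < t2 by rewrite !divr_gt0// ltr_wpDr// ltr_wpDr.
have [b' [G [bG Gh bb']]] := bh _ _ M e0 t20.
have et1 : eta / 2 = t1 + Bh * t1 + Cb * t1.
  by rewrite /t1; field; apply: lt0r_neq0; rewrite ltr_wpDr// ltr_wpDr.
have et2 : eta / 2 = t2 + BF * t2 + Ca * t2.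
  by rewrite /t2; field; apply: lt0r_neq0; rewrite ltr_wpDr// ltr_wpDr.
have [/ltW p1 /ltW p2] := (t10, t20).
have [p3 p4] := (mulr_ge0 Bh0 p1, mulr_ge0 Cb0 p1).
have [p5 p6] := (mulr_ge0 BF0 p2, mulr_ge0 Ca0 p2).
exists (dconv a' b'), (fun s => F s * G s); split; first exact: dpolyM.
- move=> s es; have -> : F s * G s - g s * h s =
  F s * (G s - h s) + h s * (F s - g s) by ring.
  apply: le_trans (le_normcD _ _) _; rewrite !normcM.
  have : normc (F s) * normc (G s - h s) <= BF * t2.
    by rewrite ler_pM ?normc_ge0 ?Gh// FB//; exact: lt_trans es.
  have : normc (h s) * normc (F s - g s) <= Bh * t1.
    by rewrite ler_pM ?normc_ge0 ?Fg// hB.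
  lra.
- move=> n nM; apply: le_trans (dconv_dist p1 p2 aa' bb' nM) _.
  by rewrite -/Ca -/Cb; lra.
Qed.

Lemma uniform_dlimitM g h : uniform_dlimit g -> uniform_dlimit h ->
  uniform_dlimit (fun s => g s * h s).
Proof.
by move=> /uniform_dlimit_coef[a ag] /uniform_dlimit_coef[b bh];
  exact: has_dcoef_uniform_dlimit (has_dcoefM ag bh).
Qed.

Lemma uniform_dlimitD g h : uniform_dlimit g -> uniform_dlimit h ->
  uniform_dlimit (fun s => g s + h s).
Proof.
move=> ug uh eps eta e0 t0; have t20 : 0 < eta / 2 by rewrite divr_gt0.
have [a [F [aF Fg]]] := ug _ _ e0 t20; have [b [G [bG Gh]]] := uh _ _ e0 t20.
exists (fun n => a n + b n), (fun s => F s + G s); split; first exact: dpolyD.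
move=> s es; have -> : F s + G s - (g s + h s) = (F s - g s) + (G s - h s)
  by ring.
by apply: le_trans (le_normcD _ _) _; have := Fg s es; have := Gh s es; lra.
Qed.

Lemma uniform_dlimit_cst (c : R[i]) : uniform_dlimit (fun=> c).
Proof.
move=> eps eta e0 t0; exists (fun n => c * ddelta R 1 n), (fun s => c * cpow 1 (- s)).
split; first exact: dpolyZ (dpoly_delta _ _).
by move=> s _; rewrite cpow1 mulr1 subrr normc0 ltW.
Qed.

Lemma uniform_dlimitX g n : uniform_dlimit g ->
  uniform_dlimit (fun s => g s ^+ n).
Proof.
move=> ug; elim: n => [|n IH]; first exact: uniform_dlimit_cst.
rewrite (_ : (fun s => _) = fun s => g s * g s ^+ n);
  first exact: uniform_dlimitM.
by apply/funext => s; rewrite exprS.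
Qed.

Lemma uniform_dlimit_lim g : (forall eps eta, 0 < eps -> 0 < eta ->
  exists h, uniform_dlimit h /\
  forall s, eps < Re s -> normc (h s - g s) <= eta) -> uniform_dlimit g.
Proof.
move=> ug eps eta e0 t0; have t20 : 0 < eta / 2 by rewrite divr_gt0.
have [h [uh hg]] := ug _ _ e0 t20; have [a [F [aF Fh]]] := uh _ _ e0 t20.
exists a, F; split=> // s es; have -> : F s - g s =
  (F s - h s) + (h s - g s) by ring.
by apply: le_trans (le_normcD _ _) _; have := Fh s es; have := hg s es; lra.
Qed.

End Approximation.

(** * Exponential of a uniform limit *)

Section ExpApproximation.
Variable R : realType.
Implicit Types (z w : R[i]) (x y : R).

Lemma sin_mvt y : exists2 c, `|c| <= `|y| & sin y = cos c * y.
Proof.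
wlog y0 : y / 0 <= y.
  move=> h; have [|y0] := lerP 0 y; first exact: h.
  have [|c cy sy] := h (- y); first by rewrite oppr_ge0 ltW.
  by exists c; [rewrite -(normrN y)|apply: oppr_inj; rewrite -sinN sy mulrN].
have [<-|yn0] := eqVneq 0 y; first by exists 0; rewrite ?sin0 ?mulr0.
have yp : 0 < y by rewrite lt_neqAle yn0.
have [c cy] : exists2 c, c \in `]0, y[%R & sin y - sin 0 = cos c * (y - 0).
  apply: MVT => //; apply: continuous_subspaceT => x; exact: continuous_sin.
rewrite sin0 !subr0 => sy; exists c => //; move: cy;
  rewrite in_itv/= => /andP[c0 cy].
by rewrite !ger0_norm// ltW.
Qed.

Lemma one_sub_cos y : 0 <= 1 - cos y <= y ^+ 2 / 2.
Proof.
rewrite subr_ge0 cos_le1/= -[in cos _](@divfK _ 2 _ y)// mulr_natr cos_mulr2n.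
rewrite cos2sin2; have [c _ ->] := sin_mvt (y / 2).
have : cos c ^+ 2 <= 1 by rewrite -(cos2Dsin2 c) lerDl sqr_ge0.
move=> c1; rewrite exprMn mulr2n.
have := ler_wpM2r (sqr_ge0 y) c1; rewrite expr_div_n; lra.
Qed.

(** Second-order Taylor remainder, from 1 + x <= exp x <= 1 / (1 - x) on the real side and from the
    bounds on 1 - cos and sin on the imaginary side. *)
Lemma expC_approx1 w : normc w <= 2^-1 ->
  normc (expC w - (1 + w)) <= 4 * normc w ^+ 2.
Proof.
move=> w2; apply: le_trans (le_normc_ReIm _) _; rewrite sqr_normcE.
have := le_trans (le_Re_normc w) w2; have := le_trans (le_Im_normc w) w2.
case: w {w2} => x y /=; rewrite !add0r !mul0r subr0 addr0 => /ler_normlP[y1 y2] /ler_normlP[x1 x2].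
have e1 : 0 <= expR x - 1 - x by have := expR_ge1Dx x; lra.
have e2 : expR x * (1 - x) <= 1.
  have := expR_ge1Dx (- x); rewrite expRN -(ler_pM2l (expR_gt0 x)).
  by rewrite divff// lt0r_neq0 ?expR_gt0.
have e3 : expR x - 1 - x <= 2 * x ^+ 2 by nra.
have e4 : expR x <= 2 by have := expR_gt0 x; nra.
have e5 := expR_gt0 x.
have /andP[c0 c1] := one_sub_cos y.
have [c cy sy] := sin_mvt y.
have /andP[d0 d1] := one_sub_cos c.
have cy2 : c ^+ 2 <= y ^+ 2 by rewrite -(real_normK (num_real c)) -(real_normK (num_real y)) lerXn2r ?nnegrE.
have h1 : `|expR x * cos y - (1 + x)| <= 2 * x ^+ 2 + y ^+ 2.
  have -> : expR x * cos y - (1 + x) =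
    (expR x - 1 - x) - expR x * (1 - cos y) by ring.
  apply: le_trans (ler_normB _ _) _; rewrite normrM (ger0_norm e1) (ger0_norm (ltW e5)) (ger0_norm c0).
  have : expR x * (1 - cos y) <= 2 * (y ^+ 2 / 2) by rewrite ler_pM// ltW.
  lra.
have h2 : `|expR x * sin y - y| <= x ^+ 2 + 3 * y ^+ 2.
  have -> : expR x * sin y - y = (expR x - 1) * y - expR x * ((1 - cos c) * y).
    by rewrite sy; ring.
  have ex1 : `|expR x - 1| <= `|x| * 2.
    rewrite (_ : expR x - 1 = (expR x - 1 - x) + x); last ring.
    apply: le_trans (ler_normD _ _) _; rewrite (ger0_norm e1).
    have : x ^+ 2 <= `|x| * 2^-1.
      by rewrite -(real_normK (num_real x)) expr2 ler_wpM2l// ler_norml;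
        apply/andP; split; lra.
    lra.
  apply: le_trans (ler_normB _ _) _; rewrite !normrM (ger0_norm (ltW e5)) (ger0_norm d0).
  have y1' : `|y| <= 2^-1 by rewrite ler_norml; apply/andP; split; lra.
  have A : `|expR x - 1| * `|y| <= `|x| * 2 * `|y| by rewrite ler_wpM2r.
  have B : (1 - cos c) * `|y| <= y ^+ 2 / 2 * 2^-1.
    by rewrite ler_pM// (le_trans d1)// ler_wpM2r// invr_ge0.
  have C : expR x * ((1 - cos c) * `|y|) <= 2 * (y ^+ 2 / 2 * 2^-1).
    by rewrite ler_pM ?mulr_ge0// ltW.
  have D : 0 <= (`|x| - `|y|) ^+ 2 by rewrite sqr_ge0.
  rewrite sqrrB !real_normK ?num_real// in D.
  rewrite -mulr_natr in D; have y20 := sqr_ge0 y.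
  move: A; rewrite mulrAC -[_ * _ * 2]mulrA; lra.
(* The bounds [h1] and [h2] add up to 3 x ^ 2 + 4 y ^ 2, whence the constant 4. *)
have := sqr_ge0 x; have := sqr_ge0 y; lra.
Qed.

Lemma normc_subXX z w (m : R) n : normc z <= m -> normc w <= m -> 1 <= m ->
  normc (z ^+ n - w ^+ n) <= normc (z - w) * (n%:R * m ^+ n).
Proof.
move=> zm wm m1; rewrite subrXX normcM ler_wpM2l ?normc_ge0//.
apply: le_trans (normc_sum _ _ _) _; rewrite mulr_natl -[X in _ *+ X]card_ord -sumr_const.
apply: ler_sum => i _; rewrite normcM !normcX.
have -> : m ^+ n = m * (m ^+ (n.-1 - i) * m ^+ i).
  by rewrite -exprD subnK -?exprS ?prednK//; have := ltn_ord i; lia.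
have m0 : 0 <= m by rewrite (le_trans ler01).
rewrite -[leLHS]mul1r ler_pM// ?mulr_ge0 ?exprn_ge0 ?normc_ge0//.
by rewrite ler_pM ?exprn_ge0 ?normc_ge0 ?lerXn2r ?nnegrE ?normc_ge0.
Qed.

(** Both sides are n-th powers, of 1 + z / n and exp (z / n). The bases differ by at most 4 |z / n|
    ^ 2 and have modulus at most exp (|z| / n), so that passing to the powers costs a factor n * exp
    |z|. *)
Lemma expC_approx z n : (0 < n)%N -> 2 * normc z <= n%:R ->
  normc ((1 + n%:R^-1 * z) ^+ n - expC z) <=
  4 * normc z ^+ 2 * expR (normc z) / n%:R.
Proof.
move=> n0 zn; have n0' : 0 < n%:R :> R by rewrite ltr0n.
pose w := n%:R^-1 * z.
have nw : normc w = normc z / n%:R.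
  rewrite normcM normcV -(rmorph_nat (real_complex R)) normcR ger0_norm ?ltW//.
  by rewrite mulrC.
have -> : expC z = expC w ^+ n.
  by rewrite -expC_nat mulrA divff ?mul1r// pnatr_eq0 -lt0n.
have w2 : normc w <= 2^-1 by rewrite nw ler_pdivrMr//; lra.
rewrite distcC; apply: le_trans (@normc_subXX _ _ (expR (normc w)) n _ _ _) _.
- by rewrite normc_expC ler_expR (le_trans (ler_norm _))// le_Re_normc.
- apply: le_trans (le_normcD _ _) _; rewrite normc1; exact: expR_ge1Dx.
- by rewrite -expR0 ler_expR normc_ge0.
rewrite -expRM_natr nw divfK ?lt0r_neq0//.
have -> : 4 * normc z ^+ 2 * expR (normc z) / n%:R =
   4 * (normc z / n%:R) ^+ 2 * (n%:R * expR (normc z)).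
  by field; rewrite lt0r_neq0.
rewrite ler_wpM2r ?mulr_ge0 ?expR_ge0// -nw; exact: expC_approx1.
Qed.

(** On each half-plane Re s > eps the function [g] is bounded, so (1 + g / n) ^ n converges
    uniformly there, and these powers are again uniform limits of Dirichlet polynomials. *)
Lemma uniform_dlimit_expC (g : R[i] -> R[i]) : uniform_dlimit g ->
  uniform_dlimit (fun s => expC (g s)).
Proof.
move=> ug; apply: uniform_dlimit_lim => eps eta e0 t0.
have [B B0 gB] := uniform_dlimit_bounded ug e0.
pose K := 4 * B ^+ 2 * expR B.
have K0 : 0 <= K by rewrite !mulr_ge0 ?expR_ge0// sqr_ge0.
pose n := (Num.truncn (2 * B + K / eta)).+1.
have nB : 2 * B + K / eta <= n%:R by rewrite ltW// truncnS_gt.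
have Ke0 : 0 <= K / eta by rewrite divr_ge0// ltW.
exists (fun s => (1 + n%:R^-1 * g s) ^+ n); split.
  apply: uniform_dlimitX; apply: uniform_dlimitD;
    first exact: uniform_dlimit_cst.
  by apply: uniform_dlimitM => //; exact: uniform_dlimit_cst.
move=> s es; have sB := gB s es; have s0 := normc_ge0 (g s).
apply: le_trans (expC_approx _ _) _ => //; first by lra.
rewrite ler_pdivrMr ?ltr0n//; apply: (@le_trans _ _ K).
  rewrite /K ler_pM ?mulr_ge0 ?expR_ge0 ?sqr_ge0 ?ler_expR//.
  by rewrite ler_wpM2l// lerXn2r ?nnegrE.
by rewrite mulrC -ler_pdivrMr//; lra.
Qed.

End ExpApproximation.

(** * Multiplication by a function bounded by 1 *)

Section Contraction.
Variable R : realType.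
Implicit Types (a b f : nat -> R[i]) (g : R[i] -> R[i]) (s : R[i]) (x : R).

Lemma weight_ge0 x n : 0 <= weight x n. Proof. exact: expR_ge0. Qed.

Lemma weight_le1 x n : 0 <= x -> (0 < n)%N -> weight x n <= 1.
Proof.
move=> x0 n0; rewrite -[leRHS]expR0 ler_expR mulNr oppr_le0 mulr_ge0// ln_ge0//.
by rewrite ler1n.
Qed.

Lemma weight_anti x m n : 0 <= x -> (0 < m <= n)%N -> weight x n <= weight x m.
Proof.
move=> x0 /andP[m0 mn]; rewrite ler_expR !mulNr lerN2 ler_wpM2l//.
by rewrite ler_ln ?posrE ?ltr0n// ?ler_nat// (leq_trans m0).
Qed.

(** A polynomial within [t] of [g] on Re s > t is bounded there by 1 + t, and [dpoly_contraction]
    applies to it at abscissa 2 t. As the sums are finite, all the errors vanish when [t] tends to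
    0. *)
Lemma has_dcoef_contraction b g f M : has_dcoef b g ->
    (forall s, 0 < Re s -> normc (g s) <= 1) ->
  \sum_(1 <= n < M) normc (dconv b f n) ^+ 2 <= \sum_(1 <= n < M) normc (f n) ^+ 2.
Proof.
move=> bg g1; set U := \sum_(1 <= n < M) _; set V := \sum_(1 <= n < M) _.
have [M1|M1] := leqP M 1; first by rewrite /U /V !big_geq.
pose C : R := \sum_(1 <= d < M) \sum_(1 <= e < M) normc (f e).
have C0 : 0 <= C by do 2![apply: sumr_ge0 => ? _]; exact: normc_ge0.
have V0 : 0 <= V by apply: sumr_ge0 => ? _; exact: sqr_ge0.
(* Removing the weights at abscissa 2 t costs M ^ (4 t), the exponential factor. The outer 1 + t and
   the last term come from (p + C t) ^ 2 <= (1 + t) p ^ 2 + 2 t C ^ 2, valid for t <= 1 and summed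
   over fewer than [M] indices. *)
pose rhs (t : R) := (1 + t) * ((1 + t) * (1 + t) * V * expR (t * (4 * ln M%:R))) + t * (2 * C ^+ 2 * M%:R).
have key t : 0 < t -> t <= 1 -> U <= rhs t.
  move=> t0 t1; have [a' [F [aF Fg aa']]] := bg _ _ M t0 t0.
  have FB s : t < Re s -> normc (F s) <= 1 + t.
    move=> ts; rewrite (_ : F s = g s + (F s - g s)); last by ring.
    apply: le_trans (le_normcD _ _) _; rewrite lerD ?Fg// g1//;
      exact: lt_trans ts.
  have t12 : t < 2 * t by lra.
  have t10 : 0 <= 1 + t by lra.
  have := dpoly_contraction f M aF t10 FB t12.
  set A := \sum_(1 <= n < M) _; set B := \sum_(1 <= n < M) _ => AB.
  have BV : B <= V.
    apply: ler_sum_nat => n /andP[n1 nM];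
      rewrite lerXn2r ?nnegrE ?mulr_ge0 ?normc_ge0 ?weight_ge0//.
    by rewrite ler_piMr ?normc_ge0// weight_le1//; lra.
  pose U' := \sum_(1 <= n < M) normc (dconv a' f n) ^+ 2.
  have U'A : U' <= A * expR (t * (4 * ln M%:R)).
    rewrite mulr_suml; apply: ler_sum_nat => n /andP[n1 nM].
    rewrite exprMn -mulrA ler_peMr ?sqr_ge0//.
    apply: (@le_trans _ _ (weight (2 * t) M ^+ 2 * expR (t * (4 * ln M%:R)))).
      rewrite -expRM_natr -expRD -[leLHS]expR0 ler_expR; lra.
    rewrite ler_wpM2r ?expR_ge0// lerXn2r ?nnegrE ?weight_ge0// weight_anti//;
      first lra.
    by rewrite n1 ltnW.
  have UU' : U <= (1 + t) * U' + t * (2 * C ^+ 2 * M%:R).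
    have -> : (1 + t) * U' + t * (2 * C ^+ 2 * M%:R) = \sum_(1 <= n < M)
        (1 + t) * normc (dconv a' f n) ^+ 2 + \sum_(0 <= n < M) t * (2 * C ^+ 2).
      by rewrite -mulr_sumr big_const_nat subn0 iter_addr_0 -[X in _ =
        _ + X]mulr_natr -/U'; ring.
    apply: (@le_trans _ _ (\sum_(1 <= n < M)
        ((1 + t) * normc (dconv a' f n) ^+ 2 + t * (2 * C ^+ 2)))); last first.
      rewrite big_split/= lerD2l [leRHS]big_ltn ?(ltnW M1)// lerDr.
      by rewrite !mulr_ge0// ltW.
    apply: ler_sum_nat => n nM.
    have ff k : (0 < k < M)%N -> normc (f k - f k) <= 0 by rewrite subrr normc0.
    have := dconv_dist (ltW t0) (lexx 0) aa' ff nM.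
    rewrite mulr0 add0r -/C distcC => h.
    have h' : normc (dconv b f n) <= normc (dconv a' f n) + C * t.
      rewrite (_ : dconv b f n = dconv a' f n + (dconv b f n - dconv a' f n));
        last by ring.
      by apply: le_trans (le_normcD _ _) _; rewrite lerD.
    have p0 := normc_ge0 (dconv a' f n);
      have Ct0 : 0 <= C * t by rewrite mulr_ge0// ltW.
    move: h'; rewrite -(@ler_sqr _ (normc _)) ?nnegrE ?normc_ge0 ?addr_ge0// => h'.
    apply: le_trans h' _; set p := normc _ in p0 *.
    have q : 0 <= t * (p - C) ^+ 2 by rewrite mulr_ge0 ?(ltW t0) ?sqr_ge0.
    have q' : t * (t * C ^+ 2) <= t * C ^+ 2.
      by rewrite ler_wpM2l ?(ltW t0)// ler_piMl// sqr_ge0.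
    have e1 : t * (p - C) ^+ 2 = t * p ^+ 2 + t * C ^+ 2 - 2 * (p * (C * t))
      by ring.
    have e2 : (p + C * t) ^+ 2 = p ^+ 2 + t * (t * C ^+ 2) + 2 * (p * (C * t)) by ring.
    have e3 : (1 + t) * p ^+ 2 + t * (2 * C ^+ 2) =
      p ^+ 2 + t * p ^+ 2 + 2 * (t * C ^+ 2) by ring.
    rewrite e2 e3; lra.
  apply: le_trans UU' _; rewrite lerD2r ler_wpM2l//.
  apply: le_trans U'A _; rewrite ler_wpM2r ?expR_ge0//.
  apply: le_trans AB _; rewrite -expr2 ler_wpM2l ?sqr_ge0//.
have rl : rhs \o @harmonic R @ \oo --> V.
  have -> : V = rhs 0.
    by rewrite /rhs !mul0r addr0 expR0 !addr0 !mul1r mulr1.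
  apply: (cvg_comp (@harmonic R) rhs (@cvg_harmonic R)).
  rewrite /rhs; apply: cvgD.
    apply: cvgM; first by apply: cvgD; [exact: cvg_cst|exact: cvg_id].
    apply: cvgM; last first.
      apply: (cvg_comp (fun t : R => t * (4 * ln M%:R)) expR);
        last exact: continuous_expR.
      by apply: cvgMl; exact: cvg_id.
    apply: cvgMl; apply: cvgM; apply: cvgD; by [exact: cvg_cst|exact: cvg_id].
  by apply: cvgMl; exact: cvg_id.
apply: (ler_cvg_to (cvg_cst U) rl); apply: nearW => n /=.
by apply: key; rewrite ?invr_gt0// invf_le1// ler1n.
Qed.

End Contraction.

(** * Convergence and uniqueness of Dirichlet series *)

Section Evaluation.
Variable R : realType.
Implicit Types (a b f u : nat -> R[i]) (g : R[i] ->
  R[i]) (s : R[i]) (x delta : R).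

Lemma weightD x y n : weight (x + y) n = weight x n * weight y n :> R.
Proof. by rewrite /weight -expRD -mulrDl opprD. Qed.

Lemma normc_cpow_nat n s : normc (cpow n%:R (- s)) = weight (Re s) n.
Proof. by rewrite normc_cpow raddfN. Qed.

(** With d = 2 x - 1, the term n ^ (- 2 x) is at most v (n - 1) - v n, where v n = n ^ (- d) / d is
    the integral of the tail; the sum telescopes. *)
Lemma pseries_tail x t : 2^-1 < x -> 0 < t ->
  exists N0, forall N D, (N0 <= N)%N -> \sum_(N <= n < D) weight x n ^+ 2 <= t.
Proof.
move=> x2 t0; pose d := 2 * x - 1; have d0 : 0 < d by rewrite /d; lra.
pose v n : R := weight d n / d.
have step n : (1 < n)%N -> weight x n ^+ 2 <= v n.-1 - v n.
  case: n => [//|n] n0; rewrite -/(n.+1.-1) /=;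
    have n0' : 0 < n%:R :> R by rewrite ltr0n.
  have n1 : 0 < n.+1%:R :> R by rewrite ltr0n.
  rewrite -mulrBl ler_pdivlMr//.
  have -> : weight x n.+1 ^+ 2 = weight d n.+1 * n.+1%:R^-1.
    rewrite -[n.+1%:R in RHS](@lnK R) ?posrE// -expRN -expRD -expRM_natr.
    by congr expR; rewrite /d; ring.
  have -> : weight d n = weight d n.+1 * expR (d * (ln n.+1%:R - ln n%:R)).
    by rewrite -expRD; congr expR; ring.
  rewrite -mulrA -[X in _ - X]mulr1 -mulrBr ler_wpM2l ?expR_ge0//.
  apply: le_trans (_ : d * (ln n.+1%:R - ln n%:R) <= _); last first.
    by have := expR_ge1Dx (d * (ln n.+1%:R - ln n%:R) : R); lra.
  rewrite mulrC ler_wpM2l ?(ltW d0)//.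
  have -> : ln n.+1%:R - ln n%:R = - ln (1 + - n.+1%:R^-1) :> R.
    have -> : 1 + - n.+1%:R^-1 = n%:R / n.+1%:R :> R.
      by rewrite -natr1 in n1 *; field; rewrite lt0r_neq0.
    by rewrite ln_div ?posrE// opprB.
  rewrite lerNr; apply: le_ln1Dx.
  by rewrite ltrN2 invf_lt1// ltr1n.
have v0 n : 0 <= v n by rewrite divr_ge0 ?expR_ge0// ltW.
have tele N D : (1 <= N)%N -> \sum_(N.+1 <= n < D) weight x n ^+ 2 <= v N.
  move=> N1; have [DN|ND] := leqP D N.+1; first by rewrite big_geq.
  apply: (@le_trans _ _ (\sum_(N.+1 <= n < D) (v n.-1 - v n))).
    by apply: ler_sum_nat => n /andP[Nn _]; apply: step; lia.
  case: D ND => // D ND; rewrite big_add1/= (eq_bigr (fun n => - (v n.+1 - v n))).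
    rewrite sumrN telescope_sumr; last by lia.
    by have := v0 D; lra.
  by move=> n _; rewrite opprB.
(* [v N] is at most [t] as soon as N >= (t d) ^ (- 1 / d). *)
pose N0 := (Num.truncn (expR (- ln (t * d) / d))).+1.
exists N0.+1 => -[//|N] D NN; apply: le_trans (tele _ _ _) _; first by lia.
rewrite /v ler_pdivrMr// -[leRHS](@lnK R) ?posrE ?mulr_gt0// ler_expR.
rewrite mulNr lerNl -ler_pdivrMl// mulrC -ler_expR lnK ?posrE ?ltr0n;
  last by lia.
apply: le_trans (ltW (truncnS_gt _)) _; by rewrite ler_nat.
Qed.

(** Cauchy-Schwarz in the form p w <= (k p ^ 2 + w ^ 2 / k) / 2. The threshold does not depend on
    [a], which allows an approximant that varies with the truncation point. *)
Lemma dirichlet_tail x y B delta : 2^-1 < y -> 0 <= B -> 0 < delta ->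
  exists N0, forall N D a, (N0 <= N)%N ->
    \sum_(N <= n < D) (normc (a n) * weight x n) ^+ 2 <= B ->
    \sum_(N <= n < D) normc (a n) * weight (x + y) n <= delta.
Proof.
move=> y2 B0 d0; pose k := delta / (B + 1).
have k0 : 0 < k by rewrite divr_gt0// ltr_wpDl.
have [N0 hN0] := pseries_tail y2 (mulr_gt0 d0 k0).
exists N0 => N D a NN h; have {hN0} := hN0 N D NN => h'.
apply: (@le_trans _ _ (\sum_(N <= n < D)
    (k * (normc (a n) * weight x n) ^+ 2 + weight y n ^+ 2 / k) / 2)).
  apply: ler_sum_nat => n _; rewrite weightD mulrA.
  set p := normc _ * _; set w := weight y n.
  have -> : (k * p ^+ 2 + w ^+ 2 / k) / 2 = p * w + (k * p - w) ^+ 2 / k / 2.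
    by field; rewrite lt0r_neq0.
  by rewrite lerDl divr_ge0// divr_ge0 ?(ltW k0) ?sqr_ge0.
rewrite -mulr_suml big_split/= -mulr_sumr -mulr_suml.
have h1 : k * \sum_(N <= n < D) (normc (a n) * weight x n) ^+ 2 <= delta.
  apply: le_trans (ler_wpM2l (ltW k0) h) _.
  rewrite /k mulrAC ler_pdivrMr ?ltr_wpDl// ler_wpM2l ?(ltW d0)//; lra.
have h2 : (\sum_(N <= n < D) weight y n ^+ 2) / k <= delta
  by rewrite ler_pdivrMr.
lra.
Qed.

Lemma dpsum_dist a N D s : (1 <= N <= D)%N ->
  normc (dpsum a D s - dpsum a N s) <= \sum_(N <= n < D) normc (a n) * weight (Re s) n.
Proof.
move=> /andP[N1 ND]; rewrite /dpsum (big_cat_nat N1 ND)/= addrAC subrr add0r.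
apply: le_trans (normc_sum _ _ _) _; apply: ler_sum => n _.
by rewrite normcM normc_cpow_nat.
Qed.

Definition dirichlet_cvg a s l : Prop := forall delta, 0 < delta ->
  exists N0, forall N, (N0 <= N)%N -> normc (dpsum a N s - l) <= delta.

Lemma sub_sum_nat (c : nat -> R) N D : (forall n, 0 <= c n) -> (1 <= N)%N ->
  \sum_(N <= n < D) c n <= \sum_(1 <= n < D) c n.
Proof.
move=> c0 N1; have [ND|DN] := leqP N D.
  by rewrite [leRHS](big_cat_nat N1 ND)/= lerDr sumr_ge0.
by rewrite big_geq ?(ltnW DN)// sumr_ge0.
Qed.

(** For each [N] an approximant is taken whose first coefficients are so close to those of [b] that
    the partial sums up to [N] nearly agree. Its own tail beyond [N] is small by [dirichlet_tail],
    the weighted square sums of all these approximants being at most 4. *)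
Lemma has_dcoef_eval b g s : has_dcoef b g -> (forall z, 0 < Re z ->
  normc (g z) <= 1) ->
  2^-1 < Re s -> dirichlet_cvg b s (g s).
Proof.
move=> bg g1 s2 d d0; pose e := (Re s - 2^-1) / 4;
  have e0 : 0 < e by rewrite /e; lra.
have y2 : 2^-1 < Re s - 2 * e by rewrite /e; lra.
have d20 : 0 < d / 2 by rewrite divr_gt0.
have [N0 hN0] := @dirichlet_tail (2 * e) _ (2 ^+ 2) _ y2 (sqr_ge0 _) d20.
(* [N] times [t] pays for the coefficients and one more [t] for the distance from [F] to [g]:
   together at most d / 2. *)
exists N0.+1 => N NN; pose t := Num.min 1 (d / 2 / N.+1%:R).
have t0 : 0 < t by rewrite lt_min ltr01 divr_gt0.
have t1 : t <= 1 by rewrite ge_min lexx.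
have tN : t * N.+1%:R <= d / 2 by rewrite -ler_pdivlMr// ge_min lexx orbT.
have [a [F [aF Fg ab]]] := bg _ _ N e0 t0.
have FB z : e < Re z -> normc (F z) <= 2.
  move=> ez; rewrite (_ : F z = (F z - g z) + g z); last by ring.
  apply: le_trans (le_normcD _ _) _.
  by have := Fg z ez; have := g1 z (lt_trans e0 ez); lra.
have [D [aD FD]] := aF.
have aS := @dpoly_sum_le _ _ _ _ _ (2 * e) (N + D)%N aF (ler0n _ 2) _ FB.
have h1 : normc (dpsum a (N + D)%N s - dpsum a N s) <= d / 2.
  apply: le_trans (dpsum_dist _ _ _) _; first by apply/andP; split; lia.
  rewrite -[Re s](subrKC (2 * e)); apply: hN0; first by lia.
  apply: le_trans (sub_sum_nat _ _ _) (aS _); [by move=> n;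
    exact: sqr_ge0|lia|lra].
have h2 : normc (dpsum b N s - dpsum a N s) <= t * N%:R.
  rewrite /dpsum -sumrB; apply: le_trans (normc_sum _ _ _) _.
  apply: (@le_trans _ _ (\sum_(1 <= n < N) t)).
    apply: ler_sum_nat => n nN; rewrite -mulrBl normcM normc_cpow_nat distcC.
    rewrite -[leRHS]mulr1 ler_pM ?normc_ge0 ?expR_ge0 ?ab//.
    have /andP[n1 _] := nN; rewrite weight_le1//; lra.
  rewrite big_const_nat iter_addr_0 -[leLHS]mulr_natr ler_wpM2l ?(ltW t0)// ler_nat.
  lia.
have h3 : normc (F s - g s) <= t by apply: Fg; rewrite /e; lra.
rewrite (FD (N + D)%N) in h3; last by lia.
rewrite (_ : _ - _ = (dpsum b N s - dpsum a N s) - (dpsum a (N + D)%N s - dpsum a N s)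
  + (dpsum a (N + D)%N s - g s)); last by ring.
apply: le_trans (le_normcD _ _) _; apply: le_trans (lerD (le_normcD _ _) (lexx _)) _.
rewrite normcN; move: tN; rewrite -natr1 mulrDr mulr1; lra.
Qed.

Lemma l2_dirichlet_cvg a B s : (forall M, \sum_(1 <= n < M) normc (a n) ^+ 2 <= B) ->
  2^-1 < Re s -> exists l, dirichlet_cvg a s l.
Proof.
move=> aB s2; have B0 : 0 <= B by have := aB 0%N; rewrite big_geq.
have cau d : 0 < d -> exists N0, forall N D, (N0 <= N <= D)%N ->
    normc (dpsum a D s - dpsum a N s) <= d.
  move=> d0; have [N0 hN0] := @dirichlet_tail 0 _ _ _ s2 B0 d0.
  exists N0.+1 => N D NND; apply: le_trans (dpsum_dist _ _ _) _; first by lia.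
  rewrite -[Re s]add0r; apply: hN0; first by lia.
  have -> : \sum_(N <= n < D) (normc (a n) * weight 0 n) ^+ 2
      = \sum_(N <= n < D) normc (a n) ^+ 2.
    by apply: eq_bigr => n _; rewrite /weight oppr0 mul0r expR0 mulr1.
  apply: le_trans (sub_sum_nat _ _ _) (aB D); [by move=> n; exact: sqr_ge0|lia].
have /choice[N hN] : forall k, exists N0, forall N D, (N0 <= N <= D)%N ->
    normc (dpsum a D s - dpsum a N s) <= k.+1%:R^-1.
  by move=> k; apply: cau; rewrite invr_gt0.
have [|l hl] := @complex_cauchy _ (fun k => dpsum a (N k) s) (fun k => k.+1%:R^-1).
  move=> i j; apply: (@distc_le _ (dpsum a (maxn (N i) (N j)) s));
    rewrite distcC.
    by apply: hN; rewrite leqnn leq_maxl.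
  by apply: hN; rewrite leqnn leq_maxr.
(* The 3 is one unit for the tail beyond [N k] and two for the rate given by [complex_cauchy]. *)
exists l => d d0; pose k := Num.truncn (3 / d).
have kd : 3 * k.+1%:R^-1 <= d.
  by rewrite ler_pdivrMr// mulrC -ler_pdivrMr// ltW// truncnS_gt.
exists (N k) => M NM.
rewrite (_ : _ - _ = (dpsum a M s - dpsum a (N k) s) + (dpsum a (N k) s - l));
  last by ring.
apply: le_trans (le_normcD _ _) _; have /= := hl k; have := hN k (N k) M.
rewrite leqnn NM => /(_ isT); move: (k.+1%:R^-1) kd => y; lra.
Qed.

Lemma dirichlet_cvgB a b s l m : dirichlet_cvg a s l -> dirichlet_cvg b s m ->
  dirichlet_cvg (fun n => a n - b n) s (l - m).
Proof.
move=> al bm d d0; have d20 : 0 < d / 2 by rewrite divr_gt0.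
have [N1 h1] := al _ d20; have [N2 h2] := bm _ d20.
exists (maxn N1 N2) => N; rewrite geq_max => /andP[/h1 {}h1 /h2 {}h2].
have -> : dpsum (fun n => a n - b n) N s = dpsum a N s - dpsum b N s.
  by rewrite /dpsum -sumrB; apply: eq_bigr => n _; rewrite mulrBl.
rewrite (_ : _ - _ - _ = (dpsum a N s - l) - (dpsum b N s - m)); last by ring.
by apply: le_trans (le_normcD _ _) _; rewrite normcN; lra.
Qed.

Lemma weight_nat k n : (0 < n)%N -> weight k%:R n = n%:R ^- k :> R.
Proof.
move=> n0; rewrite /weight mulNr expRN mulrC expRM_natr lnK//.
by rewrite posrE ltr0n.
Qed.

Lemma sum_inv_sqr n M : (0 < n)%N ->
  \sum_(n.+1 <= m < M) (m%:R ^- 2) <= n%:R^-1 :> R.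
Proof.
move=> n0; have [DN|ND] := leqP M n.+1; first by rewrite big_geq// invr_ge0.
apply: (@le_trans _ _ (\sum_(n.+1 <= m < M) (m.-1%:R^-1 - m%:R^-1))).
  apply: ler_sum_nat => -[//|m] /andP[nm _] /=.
  have m0 : 0 < m%:R :> R by rewrite ltr0n; lia.
  rewrite -natr1; set y := m%:R in m0 *.
  have -> : y^-1 - (y + 1)^-1 = (y * (y + 1))^-1.
    by field; rewrite !lt0r_neq0// ltr_wpDr.
  by rewrite lef_pV2 ?posrE ?exprn_gt0 ?mulr_gt0 ?ltr_wpDr//; nra.
case: M ND => // M ND; rewrite big_add1/= (eq_bigr (fun m => - (m.+1%:R^-1 - m%:R^-1))).
  rewrite sumrN telescope_sumr; last by lia.
  by rewrite opprB lerBlDr lerDl invr_ge0.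
by move=> m _; rewrite opprB.
Qed.

(** If [u] vanishes below [n], then at s = j + 2 the term of index [n] is balanced by the later
    ones, which are at most B (n + 1) ^ (- j) times the tail of the sum of m ^ (- 2). Hence |u n| (1
    + 1 / n) ^ j <= B n for all [j], and Bernoulli's inequality forces u n = 0. *)
Lemma dirichlet_cvg_eq0 u B : (forall n, (0 < n)%N -> normc (u n) <= B) ->
  (forall s, 2^-1 < Re s -> dirichlet_cvg u s 0) -> forall n, (0 < n)%N ->
    u n = 0.
Proof.
move=> uB u0 n; elim/ltn_ind: n => n IH n0.
have B0 : 0 <= B by apply: le_trans (uB _ n0); exact: normc_ge0.
have n0' : 0 < n%:R :> R by rewrite ltr0n.
pose c := normc (u n).
have main j : c * n%:R ^- j.+2 <= B * n%:R^-1 * n.+1%:R ^- j.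
  apply/ler_addgt0Pr => d d0.
  have [|N0 hN] := u0 (j.+2%:R) _ d d0.
    by rewrite -(rmorph_nat (real_complex R))/= (@lt_le_trans _ _ 1)// ?ler1n// invf_lt1 ?ltr1n.
  pose M := (N0 + n.+1)%N; have := hN M (leq_addr _ _); rewrite subr0 => hM.
  have -> : c * n%:R ^- j.+2 = normc (u n * cpow n%:R (- j.+2%:R)).
    by rewrite normcM normc_cpow_nat -(rmorph_nat (real_complex R))/= weight_nat.
  have -> : u n * cpow n%:R (- j.+2%:R) = dpsum u M j.+2%:R
      - \sum_(n.+1 <= m < M) u m * cpow m%:R (- j.+2%:R).
    rewrite /dpsum (@big_cat_nat _ _ _ n)//=; last by rewrite /M; lia.
    rewrite [X in X + _ - _]big_nat_cond big1 ?add0r; last first.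
      by move=> m /andP[/andP[m1 mn] _]; rewrite IH// mul0r.
    by rewrite big_ltn ?addrK// /M; lia.
  apply: le_trans (le_normcD _ _) _; rewrite normcN addrC lerD//.
  apply: le_trans (normc_sum _ _ _) _.
  apply: (@le_trans _ _ (\sum_(n.+1 <= m < M) B * n.+1%:R ^- j * m%:R ^- 2)).
    apply: ler_sum_nat => m /andP[nm _].
    have m0 : (0 < m)%N by lia.
    rewrite normcM normc_cpow_nat -(rmorph_nat (real_complex R))/= weight_nat//.
    rewrite -mulrA ler_pM ?normc_ge0 ?invr_ge0 ?exprn_ge0 ?uB//.
    rewrite -addn2 exprD invfM ler_wpM2r ?invr_ge0 ?exprn_ge0//.
    by rewrite lef_pV2 ?posrE ?exprn_gt0 ?ltr0n// lerXn2r ?nnegrE ?ler_nat.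
  rewrite -mulr_sumr [leRHS]mulrAC ler_wpM2l ?sum_inv_sqr//.
  by rewrite mulr_ge0 ?invr_ge0 ?exprn_ge0.
have bern j : 1 + j%:R * n%:R^-1 <= (1 + n%:R^-1) ^+ j :> R.
  elim: j => [|j IHj]; first by rewrite mul0r addr0 expr0.
  rewrite exprS; have i0 : 0 < n%:R^-1 :> R by rewrite invr_gt0.
  apply: le_trans (ler_wpM2l _ IHj); last by lra.
  rewrite -[j.+1%:R]natr1; set y := n%:R^-1 in i0 *.
  have : 0 <= j%:R * y * y by rewrite !mulr_ge0// ltW.
  by rewrite mulrDl !mulrDr mul1r; move: (j%:R : R) => q; lra.
have main2 j : c * (1 + j%:R * n%:R^-1) <= B * n%:R.
  have := main j.
  have e : n%:R ^- j.+2 = n%:R ^- 2 * (1 + n%:R^-1) ^+ j * n.+1%:R ^- j :> R.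
    rewrite (_ : 1 + n%:R^-1 = n.+1%:R / n%:R :> R); last first.
      by rewrite -natr1; field; rewrite lt0r_neq0.
    rewrite expr_div_n -addn2 exprD; field.
    by rewrite !expf_neq0// ?lt0r_neq0// pnatr_eq0.
  rewrite e !mulrA ler_pM2r ?invr_gt0 ?exprn_gt0// => h.
  apply: (@le_trans _ _ (c * (1 + n%:R^-1) ^+ j));
    first by rewrite ler_wpM2l ?normc_ge0.
  have n20 : 0 < n%:R ^+ 2 :> R by rewrite exprn_gt0.
  rewrite -(ler_pM2r (x := n%:R ^- 2)) ?invr_gt0//.
  apply: le_trans (le_trans h _); first by rewrite mulrAC.
  by rewrite -mulrA ler_wpM2l// expr2 invfM mulrA divff ?mul1r// lt0r_neq0.
apply: eq0_normc; apply/eqP; rewrite eq_le normc_ge0 andbT -/c leNgt;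
  apply/negP => c0.
pose j := (Num.truncn (B * n%:R * n%:R / c)).+1.
have := main2 j; apply/negP; rewrite -ltNge.
have : B * n%:R * n%:R / c < j%:R by exact: truncnS_gt.
rewrite ltr_pdivrMr// -ltr_pdivlMr// mulrDr mulr1 [j%:R * c]mulrC mulrA; lra.
Qed.

End Evaluation.

(** * Truncated norms and precompact sets in l2 *)

Section SquareSummableNorm.
Variable R : realType.
Implicit Types (a b : nat -> R[i]) (f g : l2 R) (K L M N : nat).

(** Defined for arbitrary sequences, so that the image under a matrix can be estimated before it is
    known to be square-summable. *)
Definition head_norm a K : R := Num.sqrt (sqsum a K).
Definition real_norm f : R := Num.sqrt (limn (sqsum f)).
Definition drop_seq L a k : R[i] := if (k < L)%N then 0 else a k.

Lemma head_norm_ge0 a K : 0 <= head_norm a K. Proof. exact: sqrtr_ge0. Qed.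

Lemma head_norm_sqr a K : head_norm a K ^+ 2 = sqsum a K.
Proof. by rewrite sqr_sqrtr// sqsum_ge0. Qed.

Lemma head_norm_leP a K (C : R) : 0 <= C ->
  (head_norm a K <= C) = (sqsum a K <= C ^+ 2).
Proof. by move=> C0; rewrite -head_norm_sqr ler_sqr// nnegrE head_norm_ge0. Qed.

Lemma eq_head_norm a b K : (forall k, (k < K)%N ->
  normc (a k) = normc (b k)) -> head_norm a K = head_norm b K.
Proof.
move=> ab; congr Num.sqrt; apply: eq_big_nat => k /andP[_ kK].
by rewrite ab.
Qed.

Lemma head_normD a b K : head_norm (fun k => a k + b k) K <= head_norm a K + head_norm b K.
Proof. exact: sqsumD. Qed.

Lemma head_normB a b K : head_norm (fun k => a k - b k) K <= head_norm a K + head_norm b K.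
Proof.
apply: le_trans (head_normD a (fun k => - b k) K) _; rewrite lerD2l.
by rewrite (@eq_head_norm _ b)// => k _; rewrite normcN.
Qed.

Lemma sqsum_mono a K M : (K <= M)%N -> sqsum a K <= sqsum a M.
Proof. exact: sqsum_nd. Qed.

Lemma head_norm_mono a K M : (K <= M)%N -> head_norm a K <= head_norm a M.
Proof. by move=> KM; rewrite ler_wsqrtr// sqsum_mono. Qed.

Lemma le_head_norm a b K : (forall k, (k < K)%N ->
  normc (a k) <= normc (b k)) -> head_norm a K <= head_norm b K.
Proof.
move=> ab; rewrite ler_wsqrtr//; apply: ler_sum_nat => k /andP[_ kK].
by rewrite lerXn2r ?nnegrE ?normc_ge0 ?ab.
Qed.

Lemma head_norm_drop_le L a K : head_norm (drop_seq L a) K <= head_norm a K.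
Proof.
by apply: le_head_norm => k _; rewrite /drop_seq; case: ifP;
  rewrite ?normc0 ?normc_ge0.
Qed.

Lemma head_norm_split L a K : head_norm a K <= head_norm a L + head_norm (drop_seq L a) K.
Proof.
pose b k := if (k < L)%N then a k else 0.
have -> : head_norm a K = head_norm (fun k => b k + drop_seq L a k) K.
  by apply: eq_head_norm => k _; rewrite /b /drop_seq; case: ifP;
    rewrite ?addr0 ?add0r.
apply: le_trans (head_normD _ _ _) _; rewrite lerD2r ler_wsqrtr//.
apply: le_trans (sqsum_mono _ (leq_maxr L K)) _.
rewrite /sqsum (@big_cat_nat _ _ _ L)//= ?leq_maxl// [X in _ + X]big_nat_cond [X in _ + X]big1 ?addr0.
  by apply: ler_sum_nat => k /andP[_ kL]; rewrite /b kL.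
by move=> k /andP[/andP[Lk _] _]; rewrite /b ltnNge Lk normc0 expr0n.
Qed.

Lemma normc_le_head_norm a k K : (k < K)%N -> normc (a k) <= head_norm a K.
Proof.
move=> kK; apply: le_trans (head_norm_mono a kK);
  rewrite -[leLHS]ger0_norm ?normc_ge0//.
by rewrite -sqrtr_sqr ler_wsqrtr// /sqsum big_nat_recr//= lerDr sqsum_ge0.
Qed.

Lemma head_norm_le_real_norm f K : head_norm f K <= real_norm f.
Proof. by rewrite ler_wsqrtr// sqsum_le_lim// l2_valP. Qed.

Lemma real_norm_le f (C : R) : (forall K, head_norm f K <= C) ->
  real_norm f <= C.
Proof.
move=> h; have C0 : 0 <= C := le_trans (head_norm_ge0 _ _) (h 0%N).
rewrite -[leRHS]ger0_norm// -sqrtr_sqr ler_wsqrtr//.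
apply: limr_le; first exact: set_mem (l2_valP f).
by apply: nearW => K; rewrite -head_norm_leP.
Qed.

Lemma real_norm_ge0 f : 0 <= real_norm f. Proof. exact: sqrtr_ge0. Qed.

Lemma normr_l2E f : `|f| = (real_norm f)%:C. Proof. by []. Qed.

Lemma head_norm_l2 a (C : R) : (forall K, head_norm a K <= C) ->
  a \in @square_summable R.
Proof.
move=> h; apply/mem_set/(@sqsum_is_cvg _ _ (C ^+ 2)) => K.
by rewrite -head_norm_leP// (le_trans (head_norm_ge0 _ _) (h 0%N)).
Qed.

Lemma l2_tail_small f (eta : R) : 0 < eta ->
  exists L, forall K, head_norm (drop_seq L f) K <= eta.
Proof.
move=> e0; have cf : cvgn (sqsum f) := set_mem (l2_valP f).
have e20 : 0 < eta ^+ 2 by rewrite exprn_gt0.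
have /cvgrPdist_le /(_ _ e20)[L _ hL] := cf; exists L => K.
have := hL L (leqnn L); rewrite ger0_norm ?subr_ge0 ?sqsum_le_lim ?l2_valP// => h.
rewrite head_norm_leP ?(ltW e0)//; apply: le_trans h; rewrite lerBrDr.
apply: le_trans (sqsum_le_lim (maxn L K) (l2_valP f)).
rewrite [leRHS]/sqsum (@big_cat_nat _ _ _ L)//= ?leq_maxl//.
rewrite -/(sqsum f L) addrC lerD2r.
apply: le_trans (sqsum_mono _ (leq_maxr L K)) _.
rewrite /sqsum (@big_cat_nat _ _ _ L)//= ?leq_maxl//.
rewrite big_nat_cond big1 ?add0r; last first.
  by move=> k /andP[/andP[_ kL] _]; rewrite /drop_seq kL normc0 expr0n.
by apply: ler_sum_nat => k /andP[Lk _]; rewrite /drop_seq ltnNge Lk.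
Qed.

Lemma l2_sumE (I : Type) (r : seq I) (P : pred I) (F : I -> l2 R) k :
  (\sum_(i <- r | P i) F i : l2 R) k = \sum_(i <- r | P i) F i k.
Proof. exact: (big_morph (fun f : l2 R => f k)). Qed.

Lemma bounded_set_real_norm (A : set (l2 R)) (B : R) : (forall f, A f ->
  real_norm f <= B) ->
  bounded_set A.
Proof.
move=> h; exists B%:C; split; first by rewrite complex_real.
move=> x Bx f Af; apply: le_trans (ltW Bx).
by rewrite normr_l2E lecR h.
Qed.

Lemma bounded_set_ex (A : set (l2 R)) : bounded_set A ->
  exists B, forall f, A f -> real_norm f <= B.
Proof.
move=> /pinfty_ex_gt0[B _ hB]; exists (Re B) => f Af;
  have : `|f| <= B := hB f Af.
by rewrite normr_l2E lecE => /andP[].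
Qed.

(** A uniform tail bound reduces norm convergence to that of finitely many coordinates, and bounded
    coordinates always converge along an ultrafilter. *)
Lemma precompact_tails (A : set (l2 R)) (B : R) : (forall f K, A f ->
  head_norm f K <= B) ->
    (forall eta, 0 < eta -> exists L, forall f K, A f ->
      head_norm (drop_seq L f) K <= eta) ->
  precompact A.
Proof.
move=> AB At; pose e j : R := j.+1%:R^-1.
have e0 j : 0 < e j by rewrite invr_gt0.
have /choice[L hL] j := At (e j) (e0 j).
(* [C] is defined by the bounds alone and is closed under coordinatewise limits, so it is compact
   and not merely precompact. *)
pose C := [set f : l2 R | (forall K, head_norm f K <= B) /\
  forall j K, head_norm (drop_seq (L j) f) K <= e j].
have AC : A `<=` C by move=> f Af; split=> [K|j K]; [exact: AB|exact: hL].
apply: precompact_subset AC _; apply: compact_precompact;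
  first exact: norm_hausdorff.
rewrite compact_ultra => F FU FC.
have Freal (c : l2 R -> R) : (forall f, C f -> `|c f| <= B) ->
    exists x, forall d, 0 < d -> F [set f | `|c f - x| <= d].
  move=> cB; have [|x [_ cx]] := @segment_compact R (- B) B (c @ F) _.
    by apply: (@filterS _ F _ C) => // f /cB; rewrite ler_norml /= in_itv.
  exists x => d d0.
  have [//|Fd] := in_ultra_setVsetC [set f | `|c f - x| <= d] FU; exfalso.
  have [||y [/= yd]] := cx [set y | ~ `|y - x| <= d] (ball x d) _ _.
  - exact: Fd.
  - exact: nbhsx_ballx.
  by rewrite /ball/= distrC => /ltW.
have coord k : exists z : R[i], forall d, 0 < d ->
  F [set f : l2 R | normc (f k - z) <= d].
  have fB (f : l2 R) : C f -> normc (f k) <= B.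
    by move=> [h _]; apply: le_trans (h k.+1); exact: normc_le_head_norm.
  have [x hx] := Freal (fun f => Re (f k)) (fun f Cf => le_trans (le_Re_normc _) (fB f Cf)).
  have [y hy] := Freal (fun f => Im (f k)) (fun f Cf => le_trans (le_Im_normc _) (fB f Cf)).
  exists (x +i* y) => d d0; have d20 : 0 < d / 2 by rewrite divr_gt0.
  apply: filterS (filterI (hx _ d20) (hy _ d20)) => f /= [h1 h2].
  by apply: le_trans (le_normc_ReIm _) _; rewrite !raddfB/=; lra.
have /choice[p hp] := coord.
have Frt K d : 0 < d -> F [set f : l2 R | head_norm (fun k => f k - p k) K <= d].
  elim: K d => [|K IH] d d0.
    by apply: filterS filterT => f _ /=;
      rewrite /head_norm /sqsum big_geq// sqrtr0 ltW.
  have d20 : 0 < d / 2 by rewrite divr_gt0.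
  apply: filterS (filterI (IH _ d20) (hp K _ d20)) => f /= [h1 h2].
  rewrite head_norm_leP ?(ltW d0)// /sqsum big_nat_recr//= -/(sqsum _ _) -head_norm_sqr.
  have := head_norm_ge0 (fun k => f k - p k) K; have := normc_ge0 (f K - p K).
  by move: (head_norm _ _) (normc _) h1 h2 => u v; nra.
have pB K : head_norm p K <= B.
  apply/ler_addgt0Pr => d d0; have [f /= [h [fB _]]] :=
    filter_ex (filterI (Frt K d d0) FC).
  have -> : head_norm p K = head_norm (fun k => f k - (f k - p k)) K.
    by apply: eq_head_norm => k _; rewrite subKr.
  by apply: le_trans (head_normB _ _ _) _; rewrite lerD.
have pt j K : head_norm (drop_seq (L j) p) K <= e j.
  apply/ler_addgt0Pr => d d0; have [f /= [h [_ ft]]] :=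
    filter_ex (filterI (Frt K d d0) FC).
  have -> : head_norm (drop_seq (L j) p) K =
    head_norm (fun k => drop_seq (L j) f k -
      drop_seq (L j) (fun k => f k - p k) k) K.
    by apply: eq_head_norm => k _; rewrite /drop_seq; case: ifP;
      rewrite ?subr0// subKr.
  apply: le_trans (head_normB _ _ _) _; rewrite lerD//.
  exact: le_trans (head_norm_drop_le _ _ _) h.
exists (L2 (head_norm_l2 pB)); split; first by split.
apply/(@cvgrPdist_le _ _ _ F _ id) => d d0.
have [d' d'0 ->] : exists2 d', 0 < d' & d = d'%:C.
  by move: d0; rewrite ltcE/= => /andP[/eqP i0 r0]; exists (Re d) => //;
    case: d i0 r0 => x y /= ->.
(* One [e j] bounds the first [L j] coordinates of the difference, two more the tails of [f] and of
   the limit. *)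
pose j := Num.truncn (3 / d').
have ej : 3 * e j <= d'.
  by rewrite ler_pdivrMr// mulrC -ler_pdivrMr// ltW// truncnS_gt.
apply: filterS (filterI (Frt (L j) _ (e0 j)) FC) => f /= [h [_ ft]].
rewrite -normrN opprB normr_l2E lecR; apply: real_norm_le => K.
apply: le_trans (head_norm_split (L j) _ _) _.
have h1 : head_norm (f - L2 (head_norm_l2 pB)) (L j) <= e j by [].
have h2 : head_norm (drop_seq (L j) (f - L2 (head_norm_l2 pB))) K <= e j + e j.
  have -> : head_norm (drop_seq (L j) (f - L2 (head_norm_l2 pB))) K =
      head_norm (fun k => drop_seq (L j) f k - drop_seq (L j) p k) K.
    by apply: eq_head_norm => k _; rewrite /drop_seq; case: ifP; rewrite ?subr0.
  by apply: le_trans (head_normB _ _ _) _; rewrite lerD.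
by move: h1 h2; lra.
Qed.

End SquareSummableNorm.

(** * Lower triangular operators: smallness and compactness *)

Section TriangularOperators.
Variable R : realType.
Implicit Types (a b : nat -> R[i]) (f g : l2 R) (K L M N : nat).

Lemma real_normZ (c : R[i]) f : real_norm (c *: f) = normc c * real_norm f.
Proof.
have : `|c *: f| = `|c| * `|f| by exact: normrZ.
by rewrite !normr_l2E normc_def -rmorphM => -[] ->; case: c.
Qed.

Lemma real_norm_eq0 f : real_norm f = 0 -> f = 0.
Proof. by move=> f0; apply: (@l2_norm_eq0 R);
  rewrite /l2_norm -/(real_norm f) f0. Qed.

Lemma real_norm0 : real_norm (0 : l2 R) = 0.
Proof. by rewrite -(scale0r (0 : l2 R)) real_normZ normc0 mul0r. Qed.

Lemma head_norm_drop_anti N M a K : (N <= M)%N ->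
  head_norm (drop_seq M a) K <= head_norm (drop_seq N a) K.
Proof.
move=> NM; apply: le_head_norm => k _; rewrite /drop_seq.
by case: ltnP => kM; [rewrite normc0 normc_ge0|rewrite ltnNge (leq_trans NM kM)].
Qed.

Lemma continuous_real_norm_bounded (T : {linear l2 R -> l2 R}) : continuous T ->
  exists2 C, 0 <= C & forall f, real_norm (T f) <= C * real_norm f.
Proof.
move=> /linear_bounded_continuous/linear_boundedP/pinfty_ex_gt0[r r0 hr].
exists (Re r); first by move: r0; rewrite ltcE/= => /andP[_ /ltW].
move=> f; have := hr f; rewrite !normr_l2E.
have -> : r = (Re r)%:C.
  by move: r0; rewrite ltcE/= => /andP[/eqP]; case: (r) => x y /= ->.
by rewrite -rmorphM lecR.
Qed.

Lemma real_norm_bounded_continuous (T : {linear l2 R -> l2 R}) (C : R) :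
  (forall f, real_norm (T f) <= C * real_norm f) -> continuous T.
Proof.
move=> hC; apply/linear_bounded_continuous/linear_boundedP.
exists C%:C; split; first by rewrite complex_real.
move=> r Cr f; apply: le_trans (ler_wpM2r (normr_ge0 f) (ltW Cr)).
by rewrite !normr_l2E -rmorphM lecR.
Qed.

Definition finite_support a : Prop := exists M, forall n, (M <= n)%N -> a n = 0.

(* A lower triangular operator maps series supported on the indices >= L to
   series supported there, so the uniform smallness of the tails over a compact
   set bounds the whole norm. *)
Lemma compact_triangular_small (T : {linear l2 R ->
  l2 R}) : compact_operator T ->
    (forall f L, finite_support f -> (forall n, (n < L)%N -> f n = 0) ->
       forall k, (k < L)%N -> T f k = 0) ->
  forall eta, 0 < eta -> exists L, forall f, finite_support f ->
    (forall n, (n < L)%N -> f n = 0) -> real_norm (T f) <= eta * real_norm f.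
Proof.
move=> cT tT eta e0; pose A := [set f : l2 R | real_norm f <= 1].
have : precompact (T @` A) by apply/cT/(@bounded_set_real_norm _ _ 1).
rewrite precompactE => /compact_near_coveringP.
(* In near-covering form, compactness of the closure of the image yields one [L] for all its points.
   Locally, half of [eta] bounds the tail of [f] and half the distance to a neighbour [g]. *)
move=> /(_ nat \oo (fun L f => forall K, head_norm (drop_seq L f) K <= eta) _)[|L _ hL].
  move=> f _; have e20 : 0 < eta / 2 by rewrite divr_gt0.
  have [L hL] := l2_tail_small f e20.
  exists (ball f (eta / 2)%:C, [set M | (L <= M)%N]).
    split; last by exists L.
    by apply: nbhsx_ballx; rewrite ltcR.
  move=> [g M] /= [fg LM] K.
  have {}fg : real_norm (f - g) <= eta / 2 by move: fg;
    rewrite -ball_normE/= normr_l2E ltcR => /ltW.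
  have -> : head_norm (drop_seq M g) K =
      head_norm (fun k => drop_seq M f k - drop_seq M (fun k => f k - g k) k) K.
    by apply: eq_head_norm => k _; rewrite /drop_seq; case: ifP;
      rewrite ?subr0// subKr.
  apply: le_trans (head_normB _ _ _) _.
  have h1 := le_trans (head_norm_drop_anti f K LM) (hL K).
  have h2 := le_trans (head_norm_drop_le M (fun k => f k - g k) K) (le_trans (head_norm_le_real_norm (f - g) K) fg).
  lra.
exists L => f [M fM] fL; have [f0|fn0] := eqVneq (real_norm f) 0.
  by rewrite (real_norm_eq0 f0) linear0 real_norm0 mulr0.
have fp : 0 < real_norm f by rewrite lt_neqAle eq_sym fn0 real_norm_ge0.
pose g := (real_norm f)^-1%:C *: f.
have gA : A g by rewrite /A/= real_normZ normcR ger0_norm ?invr_ge0 ?real_norm_ge0// mulVf.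
have gL n : (n < L)%N -> g n = 0 by move=> nL;
  rewrite /g/= -[LHS]/(_ * f n) fL// mulr0.
have gM : finite_support g.
  by exists M => n nM; rewrite /g/= -[LHS]/(_ * f n) fM// mulr0.
have -> : f = (real_norm f)%:C *: g by rewrite scalerA -rmorphM divff ?scale1r.
rewrite linearZ/= (real_normZ _ (T g)) (real_normZ _ g) [eta * _]mulrCA ler_wpM2l ?normc_ge0//.
have -> : real_norm g = 1 by rewrite /g real_normZ normcR ger0_norm ?invr_ge0 ?real_norm_ge0// mulVf.
rewrite mulr1; apply: real_norm_le => K.
have -> : head_norm (T g) K = head_norm (drop_seq L (T g)) K.
  by apply: eq_head_norm => k _; rewrite /drop_seq; case: ltnP => // kL;
    rewrite (tT g L).
by apply: (hL L (leqnn L)); apply: subset_closure; exists g.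
Qed.

Variable m : nat -> nat -> R[i].

(** [m n k] is the k-th coefficient of the image of the n-th basis vector. Only n <= k is summed, so
    the first [K] coefficients of the image depend on the first [K] of [a]; hence the hypotheses
    below compare norms truncated at the same [K]. *)
Definition tri_apply a k : R[i] := \sum_(0 <= n < k.+1) a n * m n k.

Hypothesis tri_bounded : exists2 C, 0 <= C & forall a K, head_norm (tri_apply a) K <= C * head_norm a K.
Hypothesis tri_small : forall eta, 0 < eta -> exists L, forall a,
  (forall n, (n < L)%N -> a n = 0) -> forall K, head_norm (tri_apply a) K <= eta * head_norm a K.

Lemma tri_apply_lin (c : R[i]) a b k : tri_apply (fun n => c * a n + b n) k =
  c * tri_apply a k + tri_apply b k.
Proof.
rewrite /tri_apply mulr_sumr -big_split/=; apply: eq_bigr => n _.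
by rewrite mulrDl mulrA.
Qed.

Lemma eq_tri_apply a b k : a =1 b -> tri_apply a k = tri_apply b k.
Proof. by move=> ab; apply: eq_bigr => n _; rewrite ab. Qed.

(** The sequences considered form a bounded set in a space of dimension [L], so the tails of their
    images are uniformly small; the induction splits off one basis vector, whose image is in l2. *)
Lemma tri_head_tails (B : R) L : 0 <= B -> forall eta, 0 < eta ->
  exists N, forall a, (forall n, (L <= n)%N -> a n = 0) ->
    (forall n, normc (a n) <= B) -> forall K, head_norm (drop_seq N (tri_apply a)) K <= eta.
Proof.
move=> B0; have [C C0 hC] := tri_bounded.
elim: L => [|L IH] eta e0.
  exists 0%N => a a0 _ K; rewrite (@le_trans _ _ 0) ?(ltW e0)// head_norm_leP// expr0n/=.
  rewrite /sqsum big1// => k _; rewrite /drop_seq ltn0 /tri_apply big1 ?normc0 ?expr0n//.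
  by move=> n _; rewrite a0// mul0r.
have e20 : 0 < eta / 2 by rewrite divr_gt0.
have [N hN] := IH _ e20.
pose d n : R[i] := (n == L)%:R.
have d2 : tri_apply d \in @square_summable R.
  apply: (@head_norm_l2 _ _ (C * real_norm (l2_delta R L))) => K;
    apply: le_trans (hC _ _) _.
  rewrite ler_wpM2l//; exact: (head_norm_le_real_norm (l2_delta R L)).
have eB : 0 < eta / 2 / (B + 1) by rewrite divr_gt0// ltr_wpDl.
have [M hM] := l2_tail_small (L2 d2) eB.
exists (maxn N M) => a aL aB K.
pose a' n := if n == L then 0 else a n.
have aE k : tri_apply a k = a L * tri_apply d k + tri_apply a' k.
  rewrite -tri_apply_lin; apply: eq_tri_apply => n; rewrite /d /a'.
  by case: eqP => [->|_]; rewrite ?mulr1 ?mulr0 ?addr0 ?add0r.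
have -> : head_norm (drop_seq (maxn N M) (tri_apply a)) K =
    head_norm (fun k => drop_seq (maxn N M) (fun k => a L * tri_apply d k) k
      + drop_seq (maxn N M) (tri_apply a') k) K.
  by apply: eq_head_norm => k _; rewrite /drop_seq; case: ifP;
    rewrite ?addr0// aE.
apply: le_trans (head_normD _ _ _) _; rewrite [leRHS](splitr eta) lerD//.
  have -> : head_norm (drop_seq (maxn N M) (fun k => a L * tri_apply d k)) K
      = normc (a L) * head_norm (drop_seq (maxn N M) (tri_apply d)) K.
    rewrite /head_norm (_ : sqsum _ K =
      sqsum (a L *: (drop_seq (maxn N M) (tri_apply d) : nat -> R[i])) K).
      by rewrite sqsumZ sqrtrM ?sqr_ge0// sqrtr_sqr ger0_norm ?normc_ge0.
    apply: eq_bigr => k _; rewrite /drop_seq fctE.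
    by case: ifP => _ //; rewrite -[_ *: _]/(_ * _) mulr0.
  apply: (@le_trans _ _ ((B + 1) * (eta / 2 / (B + 1)))); last first.
    by rewrite mulrC divfK// lt0r_neq0// ltr_wpDl.
  rewrite ler_pM ?normc_ge0 ?head_norm_ge0//; first by have := aB L; lra.
  by apply: le_trans (head_norm_drop_anti _ _ (leq_maxr _ _)) _; exact: hM.
apply: le_trans (head_norm_drop_anti _ _ (leq_maxl _ _)) _; apply: hN => n.
  rewrite leq_eqVlt /a' [L == n]eq_sym; case: eqP => // _ /=; exact: aL.
by rewrite /a'; case: eqP => _; rewrite ?normc0.
Qed.

(** The operator is a limit of finite-rank ones: [tri_small] controls the image of the part of [f]
    beyond [L], [tri_head_tails] the tails of the image of the rest, and [precompact_tails]
    concludes. *)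
Lemma triangular_operator : exists T : {linear l2 R -> l2 R},
  [/\ forall f k, T f k = tri_apply f k, continuous T & compact_operator T].
Proof.
have [C C0 hC] := tri_bounded.
have l2T f K : head_norm (tri_apply f) K <= C * real_norm f.
  by apply: le_trans (hC _ _) _; rewrite ler_wpM2l// head_norm_le_real_norm.
pose T f := L2 (head_norm_l2 (l2T f)).
have linT : linear T.
  move=> c f g; apply/val_inj/funext => k /=.
  by rewrite -[RHS]/(_ * _ + _) -tri_apply_lin.
pose TL : {linear l2 R -> l2 R} := HB.pack T (GRing.isLinear.Build _ _ _ _ T linT).
exists TL; split=> //.
  by apply: (@real_norm_bounded_continuous _ C) => f; apply: real_norm_le => K;
    exact: l2T.
move=> A /bounded_set_ex[B0 AB0]; pose B := `|B0|.
have AB f : A f -> real_norm f <= B by move=> /AB0/le_trans; apply;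
  exact: ler_norm.
have B0' : 0 <= B by exact: normr_ge0.
apply: (@precompact_tails _ _ (C * B)).
  move=> _ K [f Af <-]; apply: le_trans (l2T f K) _; by rewrite ler_wpM2l// AB.
move=> eta e0; have e20 : 0 < eta / 2 by rewrite divr_gt0.
have eB : 0 < eta / 2 / (B + 1) by rewrite divr_gt0// ltr_wpDl.
have [L hL] := tri_small eB.
have [N hN] := tri_head_tails L B0' e20.
exists N => _ K [f Af <-].
pose h n := if (n < L)%N then f n else 0.
have fE k : tri_apply f k = tri_apply (drop_seq L f) k + tri_apply h k.
  rewrite -[tri_apply (drop_seq _ _) _]mul1r -tri_apply_lin;
    apply: eq_tri_apply => n.
  by rewrite mul1r /drop_seq /h; case: ifP; rewrite ?addr0 ?add0r.
have -> : head_norm (drop_seq N (TL f)) K =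
    head_norm (fun k => drop_seq N (tri_apply (drop_seq L f)) k + drop_seq N (tri_apply h) k) K.
  by apply: eq_head_norm => k _; rewrite /drop_seq; case: ifP => _;
    rewrite ?addr0//= fE.
apply: le_trans (head_normD _ _ _) _; rewrite [leRHS](splitr eta) lerD//.
  apply: le_trans (head_norm_drop_le _ _ _) _; apply: le_trans (hL _ _ K) _.
    by move=> n nL; rewrite /drop_seq nL.
  apply: (@le_trans _ _ (eta / 2 / (B + 1) * (B + 1)));
    last by rewrite divfK// lt0r_neq0// ltr_wpDl.
  rewrite ler_wpM2l ?(ltW eB)//; apply: le_trans (head_norm_drop_le _ _ _) _.
  apply: le_trans (head_norm_le_real_norm _ _) _; have := AB _ Af; lra.
apply: hN => n; first by rewrite /h ltnNge => ->.
rewrite /h; case: ifP => _; last by rewrite normc0.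
by apply: le_trans (normc_le_head_norm _ (ltnSn n)) _;
  apply: le_trans (head_norm_le_real_norm _ _) (AB _ Af).
Qed.

End TriangularOperators.

(** * Factorization of generalized integers *)

Section GeneralizedIntegers.
Variable R : realType.
Implicit Types (q lam : nat -> R) (u v t : seq R).

Lemma sum_mul_count u t : uniq t -> {subset u <= t} ->
  \sum_(x <- t) x *+ count_mem x u = \sum_(x <- u) x.
Proof.
move=> ut; elim: u => [|y u IH] sub.
  by rewrite big_nil big1// => x _; rewrite mulr0n.
under eq_bigr do rewrite /= mulrnDr.
rewrite big_split/= IH; last by move=> x xu; apply: sub; rewrite inE xu orbT.
rewrite big_cons; congr (_ + _); rewrite (bigD1_seq y) ?sub ?mem_head//= eqxx.
by rewrite big1 ?addr0// => x /negPf xy; rewrite eq_sym xy mulr0n.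
Qed.

Lemma ln_prod u : {in u, forall x, 0 < x} ->
  ln (\prod_(x <- u) x) = \sum_(x <- map (@ln R) u) x.
Proof.
elim: u => [|y u IH] u0; first by rewrite !big_nil ln1.
have u0' : {in u, forall x, 0 < x} by move=> x xu; apply: u0;
  rewrite inE xu orbT.
have P0 : 0 < \prod_(x <- u) x by rewrite big_seq; apply: prodr_gt0 => x /u0'.
by rewrite /= !big_cons lnM ?(IH u0') ?posrE ?(u0 y) ?mem_head.
Qed.

Definition generator q : set R := @real_primes R `|` range q.

Lemma generator_gt1 q x : admissible_generators q -> generator q x -> 1 < x.
Proof.
move=> [_ _ q1 _] [[p pp <-]|[n _ <-]]; last exact: q1.
by rewrite ltr1n prime_gt1.
Qed.

Lemma generator_prod_ge1 q t (P : pred R) : admissible_generators q ->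
  {in t, forall x, generator q x} -> 1 <= \prod_(x <- t | P x) x.
Proof.
move=> aq tG; rewrite big_seq_cond.
elim/big_rec : _ => [//|x y /andP[xt _] y1]; rewrite -[leLHS]mulr1 ler_pM//.
by apply/ltW/(generator_gt1 aq)/tG.
Qed.

(** Logarithms turn the equality of products into a rational relation whose coefficients [c] are the
    differences of multiplicities; linear independence makes them vanish. *)
Lemma factorization_unique q u v : admissible_generators q ->
    {in u, forall x, generator q x} -> {in v, forall x, generator q x} ->
  \prod_(x <- u) x = \prod_(x <- v) x -> perm_eq u v.
Proof.
move=> aq uG vG uv; have [_ _ _ Li] := aq.
have G0 x : generator q x -> 0 < x by move=> /(generator_gt1 aq);
  exact: lt_trans.
pose t := undup (map (@ln R) u ++ map (@ln R) v).
pose c x : rat := (count_mem x (map (@ln R) u))%:R - (count_mem x (map (@ln R) v))%:R.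
have tA x : x \in t -> ((@ln R @` @real_primes R) `|` range (fun n => ln (q n))) x.
  rewrite mem_undup mem_cat => /orP[]/mapP[y].
    by move=> /uG [yp|[n _ <-]] ->; [left; exists y|right; exists n].
  by move=> /vG [yp|[n _ <-]] ->; [left; exists y|right; exists n].
have c0 : \sum_(x <- t) ratr (c x) * x = 0.
  under eq_bigr do rewrite /c rmorphB/= !ratr_nat mulrBl !mulr_natl.
  rewrite sumrB !sum_mul_count ?undup_uniq//; last 2 first.
  - by move=> x xv; rewrite mem_undup mem_cat xv orbT.
  - by move=> x xu; rewrite mem_undup mem_cat xu.
  by rewrite -!ln_prod ?uv ?subrr// => x /=; [move=> /vG/G0|move=> /uG/G0].
have ct x := Li t c (undup_uniq _) tA c0 x.
have pln : perm_eq (map (@ln R) u) (map (@ln R) v).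
  apply/allP => x; rewrite -mem_undup => /ct /eqP; rewrite subr_eq0 eqr_nat.
  by [].
have expR_lnK w : {in w, forall x, generator q x} ->
  map expR (map (@ln R) w) = w.
  move=> wG; rewrite -map_comp -[RHS]map_id; apply/eq_in_map => x /wG/G0 x0.
  by rewrite /= lnK.
by rewrite -(expR_lnK u)// -(expR_lnK v)//; exact: perm_map.
Qed.

Lemma nat_prime_prod (a : nat) : (0 < a)%N ->
  exists2 t, {in t, forall x, @real_primes R x} & \prod_(x <- t) x = a%:R.
Proof.
elim/ltn_ind: a => a IH a0; have [a1|a1] := leqP a 1.
  by exists [::] => //; rewrite big_nil (_ : a = 1%N)//; lia.
have pp := pdiv_prime a1; have pa := pdiv_dvd a.
have [||t tp tE] := IH (a %/ pdiv a)%N.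
- by rewrite ltn_Pdiv// prime_gt1.
- by rewrite divn_gt0 ?pdiv_gt0// dvdn_leq.
exists ((pdiv a)%:R :: t).
  by move=> x; rewrite inE => /orP[/eqP ->|/tp//]; exists (pdiv a).
by rewrite big_cons tE -natrM mulnC divnK.
Qed.

Lemma prime_prod_nat t (P : pred R) : {in t, forall x, P x ->
  @real_primes R x} ->
  exists2 a : nat, (0 < a)%N & \prod_(x <- t | P x) x = a%:R.
Proof.
elim: t => [|x t IH] tp; first by exists 1%N; rewrite ?big_nil.
have [|a a0 aE] := IH; first by move=> y yt; apply: tp; rewrite inE yt orbT.
rewrite big_cons; case: ifP => Px; last by exists a.
have [p pp <-] := tp _ (mem_head _ _) Px.
by exists (p * a)%N; [rewrite muln_gt0 prime_gt0|rewrite aE natrM].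
Qed.

Lemma prod_flatten_nseq c t (P : pred R) :
  \prod_(x <- flatten (nseq c t) | P x) x = (\prod_(x <- t | P x) x) ^+ c.
Proof.
elim: c => [|c IH]; first by rewrite big_nil expr0.
by rewrite /= big_cat/= IH exprS.
Qed.

(** Tested against the primes and not against the range of [q]: the independence hypothesis concerns
    the union as a set, so some [q n] may be a prime. *)
Definition nonprime : pred R := fun x => `[< ~ @real_primes R x >].

(* The factor of a generalized integer outside the primes can be read off any
   multiple of one of its powers by a positive integer. *)
Lemma nonprime_part_inj q t t' c (a b : nat) : admissible_generators q ->
    {in t, forall x, generator q x} -> {in t', forall x, generator q x} ->
    (0 < c)%N -> (0 < a)%N -> (0 < b)%N ->
    (\prod_(x <- t | nonprime x) x) ^+ c * a%:R =
    (\prod_(x <- t' | nonprime x) x) ^+ c * b%:R ->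
  \prod_(x <- t | nonprime x) x = \prod_(x <- t' | nonprime x) x.
Proof.
move=> aq tG tG' c0 /nat_prime_prod[u up <-] /nat_prime_prod[v vp <-].
have E w z : {in z, forall x, @real_primes R x} ->
    \prod_(x <- flatten (nseq c [seq x <- w | nonprime x]) ++ z | nonprime x) x
    = (\prod_(x <- w | nonprime x) x) ^+ c.
  move=> zp; rewrite big_cat prod_flatten_nseq big_filter_cond/= [X in _ * X]big_seq_cond.
  rewrite [X in _ * X]big_pred0 ?mulr1 => [|x].
    by congr (_ ^+ _); apply: eq_bigl => x; rewrite andbb.
  by apply/negP => /andP[/zp xp /asboolP].
have G w z : {in w, forall x, generator q x} ->
  {in z, forall x, @real_primes R x} ->
    {in flatten (nseq c [seq x <- w | nonprime x]) ++ z, forall x, generator q x}.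
  move=> wG zp x; rewrite mem_cat => /orP[/flattenP[s /nseqP[-> _]]|/zp];
    last by left.
  by rewrite mem_filter => /andP[_ /wG].
rewrite -!(big_filter _ nonprime) -!prod_flatten_nseq -!big_cat/=.
move=> /(factorization_unique aq (G _ _ tG up) (G _ _ tG' vp)) pe.
have : \prod_(x <- flatten (nseq c [seq x <- t | nonprime x]) ++ u | nonprime x) x =
    \prod_(x <- flatten (nseq c [seq x <- t' | nonprime x]) ++ v | nonprime x) x.
  exact: perm_big.
rewrite !E// !big_filter => /eqP; rewrite eqrXn2//; first by move=> /eqP.
- exact: le_trans (generator_prod_ge1 _ aq tG).
- exact: le_trans (generator_prod_ge1 _ aq tG').
Qed.

(** [Q n] labels the class of [lam n], and [N n] is its position there. The last clause separates
    the classes: two columns of the matrix with a nonzero entry in the same row have the same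
    label. *)
Lemma generalized_integer_decomposition q lam : admissible_generators q ->
    increasing_enumeration lam (generalized_integers q) ->
  exists (Q : nat -> R) (N : nat -> nat),
    [/\ forall n, lam n = Q n * (N n)%:R, forall n, 1 <= Q n, forall n, (0 < N n)%N &
      forall c m n a b, (0 < c)%N -> (0 < a)%N -> (0 < b)%N ->
        Q m ^+ c * a%:R = Q n ^+ c * b%:R -> Q m = Q n].
Proof.
move=> aq [_ lamE].
have /choice[t ht] : forall n, exists t, {in t, forall x, generator q x} /\
    lam n = \prod_(x <- t) x.
  by move=> n; have : range lam (lam n) by []; rewrite lamE => -[t tG <-];
    exists t.
have /choice[N hN] : forall n, exists a : nat, (0 < a)%N /\
    \prod_(x <- t n | ~~ nonprime x) x = a%:R.
  move=> n; have [|a a0 aE] := @prime_prod_nat (t n) (fun x => ~~ nonprime x).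
    by move=> x _ /asboolPn/contrapT.
  by exists a.
exists (fun n => \prod_(x <- t n | nonprime x) x), N; split.
- move=> n; have [_ ->] := ht n; have [_ <-] := hN n.
  by rewrite (bigID nonprime).
- by move=> n; apply: (generator_prod_ge1 _ aq); exact: (ht n).1.
- by move=> n; have [] := hN n.
- move=> c m n a b c0 a0 b0; have [tm _] := ht m; have [tn _] := ht n.
  exact: nonprime_part_inj aq tm tn c0 a0 b0.
Qed.

(** The primes are generalized integers, and some prime exceeds [B]. *)
Lemma enumeration_unbounded q lam (B : R) :
    increasing_enumeration lam (generalized_integers q) ->
  exists L, forall n, (L <= n)%N -> B <= lam n.
Proof.
move=> [lami lamE]; have [p Bp pp] := prime_above (Num.truncn B).+1.
have : range lam p%:R.
  rewrite lamE; exists [:: p%:R]; last by rewrite big_seq1.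
  by move=> x; rewrite inE => /eqP ->; left; exists p.
move=> [L _ Lp]; exists L => n; rewrite leq_eqVlt => /orP[/eqP <-|/lami/ltW].
  by rewrite Lp; apply: le_trans (ltW (truncnS_gt _)) _; rewrite ler_nat ltnW.
apply: le_trans; rewrite Lp; apply: le_trans (ltW (truncnS_gt _)) _.
by rewrite ler_nat ltnW.
Qed.

End GeneralizedIntegers.

(** * The multipliers x ^ (- phi) and the matrix of the operator on ordinary series *)

Section Multipliers.
Variable R : realType.
Implicit Types (a b : nat -> R[i]) (s : R[i]) (phi : R[i] -> R[i]) (x y : R).

(** Passage between the two conventions: in l2 the coefficient of n ^ (- s) has index n - 1, in
    [dpsum] it has index [n]. *)
Lemma dirichlet_psumE a N s :
  dirichlet_psum (@positive_integers R) a N s = dpsum (fun n => a n.-1) N.+1 s.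
Proof. by rewrite /dpsum big_add1. Qed.

Lemma class_G_uniform_dlimit c0 phi : class_G_ge1 c0 phi -> uniform_dlimit phi.
Proof.
move=> [_ [c hc] _] eps eta e0 t0.
have : nbhs (phi : {uniform` half_plane eps -> R[i]})
    [set h | forall s, half_plane eps s -> normc (h s - phi s) <= eta].
  apply/uniform_nbhs; exists [set zw : R[i] * R[i] | ball zw.1 eta%:C zw.2].
  split; first by rewrite -entourage_ballE; exists eta%:C; rewrite //= ltcR.
  move=> h /= hb s es; have := hb s es;
    rewrite -ball_normE/= distrC normc_def ltcR => /ltW.
  by case: (h s - phi s).
move=> /(hc eps e0)[N _ /(_ N (leqnn N)) /= hN].
exists (fun n => if (n <= N)%N then c n.-1 else 0), (dirichlet_psum (@positive_integers R) c N).
split=> //; apply: (@dpolyI _ _ N.+1) => [n nN|s]; first by rewrite leqNgt nN.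
rewrite dirichlet_psumE; apply: eq_big_nat => n /andP[_]; by rewrite ltnS => ->.
Qed.

Lemma class_G_Re_ge0 c0 phi s : class_G_ge1 c0 phi -> 0 < Re s ->
  0 <= Re (phi s).
Proof.
move=> [_ _ [h|[tau h]]] s0; last by rewrite h.
by apply/ltW/h; exists s.
Qed.

Lemma multiplier_le1 c0 phi x s : class_G_ge1 c0 phi -> 1 <= x -> 0 < Re s ->
  normc (cpow x (- phi s)) <= 1.
Proof.
move=> hp x1 s0; rewrite normc_cpow -[leRHS]expR0 ler_expR raddfN mulNr oppr_le0.
by rewrite mulr_ge0 ?ln_ge0//; exact: class_G_Re_ge0 hp s0.
Qed.

Lemma multiplier_coef c0 phi x : class_G_ge1 c0 phi ->
  exists b, has_dcoef b (fun s => cpow x (- phi s)).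
Proof.
move=> hp; apply: uniform_dlimit_coef;
  apply: (@uniform_dlimit_expC _ (fun s => - phi s * (ln x)%:C)).
rewrite (_ : (fun s => _) = fun s => (- ln x)%:C * phi s).
  by apply: uniform_dlimitM; [exact: uniform_dlimit_cst|exact: class_G_uniform_dlimit hp].
by apply/funext => s; rewrite rmorphN mulNr mulrC mulNr.
Qed.

Lemma has_dcoef_l2 b g (gle1 : forall s, 0 < Re s ->
  normc (g s) <= 1) M : has_dcoef b g ->
  \sum_(1 <= n < M) normc (b n) ^+ 2 <= 1.
Proof.
move=> bg; have := has_dcoef_contraction (ddelta R 1) M bg gle1.
have -> : \sum_(1 <= n < M) normc (dconv b (ddelta R 1) n) ^+ 2
    = \sum_(1 <= n < M) normc (b n) ^+ 2.
  by apply: eq_big_nat => n /andP[n0 _]; rewrite dconvC dconv1.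
move=> /le_trans; apply; have [M1|M1] := leqP M 1; first by rewrite big_geq.
rewrite big_ltn// big_nat_cond big1 ?addr0.
  by rewrite /ddelta eqxx normc1 expr1n.
move=> k /andP[/andP[k2 _] _]; rewrite /ddelta gtn_eqF//.
by rewrite normc0 expr0n.
Qed.

Lemma dirichlet_cvg_dirichlet_sum a s l : dirichlet_cvg (fun n => a n.-1) s l ->
  dirichlet_sum (@positive_integers R) a s = l.
Proof.
move=> al; apply: cvg_lim; first exact: norm_hausdorff.
apply/cvgrPdist_le => d d0.
have [d' d'0 ->] : exists2 d', 0 < d' & d = d'%:C.
  by move: d0; rewrite ltcE/= => /andP[/eqP i0 r0]; exists (Re d) => //;
    case: d i0 r0 => x y /= ->.
have [N0 hN0] := al _ d'0; exists N0 => // N /= NN.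
rewrite distrC dirichlet_psumE normc_def lecR.
by have := hN0 N.+1 (leqW NN); case: (_ - l).
Qed.

Lemma normc_le_l2 a n M : (0 < n < M)%N ->
  normc (a n) ^+ 2 <= \sum_(1 <= k < M) normc (a k) ^+ 2.
Proof.
move=> nM; rewrite (bigD1_seq n) ?mem_index_iota ?iota_uniq//= lerDl.
by apply: sumr_ge0 => *; exact: sqr_ge0.
Qed.

Lemma dirichlet_sum_delta k s : dirichlet_sum (@positive_integers R) (l2_delta R k) s
  = cpow k.+1%:R (- s).
Proof.
apply: dirichlet_cvg_dirichlet_sum => d d0;
  have [D [_ hD]] := dpoly_delta R (ltn0Sn k).
exists D => N DN; rewrite (hD N)//.
rewrite (_ : dpsum _ N s = dpsum (ddelta R k.+1) N s) ?subrr ?normc0 ?ltW//.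
apply: eq_big_nat => -[//|n] _ /=; by rewrite /ddelta eqSS.
Qed.

(** Both coefficient sequences sum to (n + 1) ^ (- psi (s)) on Re s > 1/2, the left one by
    hypothesis on [T], the right one by [has_dcoef_eval]. They are bounded, so [dirichlet_cvg_eq0]
    applies to their difference. *)
Lemma composition_delta c0 phi (T : {linear l2 R -> l2 R}) n b m :
    class_G_ge1 c0 phi -> composition_operator_H2 c0 phi T ->
    has_dcoef b (fun s => cpow n.+1%:R (- phi s)) -> (0 < m)%N ->
  T (l2_delta R n) m.-1 = dconv (ddelta R (n.+1 ^ c0)%N) b m.
Proof.
move=> hp [_ hT] bphi m0.
pose g s := cpow (n.+1 ^ c0)%N%:R (- s) * cpow n.+1%:R (- phi s) : R[i].
have nc0 : (0 < n.+1 ^ c0)%N by rewrite expn_gt0.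
pose e := dconv (ddelta R (n.+1 ^ c0)%N) b.
have eg : has_dcoef e g by exact: has_dcoefM (dpoly_has_dcoef (dpoly_delta _ nc0)) bphi.
have gle1 s : 0 < Re s -> normc (g s) <= 1.
  move=> s0; rewrite normcM normc_cpow_nat -[leRHS]mulr1 ler_pM ?normc_ge0 ?weight_ge0//.
    by rewrite weight_le1// ltW.
  by apply: multiplier_le1 hp _ s0; rewrite ler1n.
pose t k := T (l2_delta R n) k.-1.
have tM M : \sum_(1 <= k < M) normc (t k) ^+ 2 <= real_norm (T (l2_delta R n)) ^+ 2.
  case: M => [|M]; first by rewrite big_geq// sqr_ge0.
  rewrite big_add1/= -/(sqsum _ M) -head_norm_leP ?real_norm_ge0//;
    exact: head_norm_le_real_norm.
have u0 s : 2^-1 < Re s -> dirichlet_cvg (fun k => t k - e k) s 0.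
  move=> s2; have [l tl] := l2_dirichlet_cvg tM s2.
  have := has_dcoef_eval eg gle1 s2; rewrite -(_ : l = g s).
    by move=> el; rewrite -(subrr l); exact: dirichlet_cvgB.
  have := dirichlet_cvg_dirichlet_sum tl;
    rewrite hT ?dirichlet_sum_delta => [<-|].
    rewrite /g /symbol opprD cpowD natrX cpowX ?ltr0n// -cpow_nat mulrN.
    by [].
  by rewrite /half_plane/= div1r.
apply/eqP; rewrite -subr_eq0; apply/eqP; apply: dirichlet_cvg_eq0 u0 _ m0.
move=> k k0; apply: le_trans (le_normcD _ _) _; rewrite normcN.
apply: (@lerD _ _ (real_norm (T (l2_delta R n))) _ 1).
  by apply: le_trans (normc_le_head_norm _ _) (head_norm_le_real_norm _ k.-1.+1).
rewrite -(@ler_sqr _ (normc _)) ?nnegrE ?normc_ge0// expr1n.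
apply: le_trans (normc_le_l2 _ (_ : (0 < k < k.+1)%N)) _;
  first by rewrite k0 ltnSn.
exact: has_dcoef_l2 gle1 _ eg.
Qed.

End Multipliers.

(** * Estimate on one class and summation over the classes *)

Section BlockEstimate.
Variable R : realType.

Lemma sum_inj_le (s : seq nat) (F : nat -> R) (idx : nat -> nat) J :
    uniq s -> {in s &, injective idx} -> {in s, forall k, (0 < idx k < J)%N} ->
    (forall j, 0 <= F j) ->
  \sum_(k <- s) F (idx k) <= \sum_(1 <= j < J) F j.
Proof.
move=> us idxI idxJ F0; rewrite -(big_map idx xpredT F).
have -> : \sum_(j <- map idx s) F j = \sum_(j <- [seq j <- index_iota 1 J | j \in map idx s]) F j.
  apply: perm_big; apply: uniq_perm; rewrite ?filter_uniq ?iota_uniq ?map_inj_in_uniq//.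
  move=> j; rewrite mem_filter mem_index_iota; apply/idP/andP => [js|[]//];
    split=> //.
  by have /mapP[k ks ->] := js; exact: idxJ.
rewrite big_filter big_mkcond; apply: ler_sum => j _.
by case: ifP.
Qed.

Lemma dconv_sum (s : seq nat) (b : nat -> R[i]) (c : nat -> R[i]) (w : nat ->
  nat -> R[i]) m :
  dconv b (fun j => \sum_(n <- s) c n * w n j) m =
    \sum_(n <- s) c n * dconv b (w n) m.
Proof.
elim: s => [|n s IH].
  rewrite big_nil /dconv big1// => d _; rewrite big1// => e _.
  by rewrite big_nil mulr0.
rewrite big_cons -IH /dconv mulr_sumr -big_split/=; apply: eq_bigr => d _.
rewrite mulr_sumr -big_split/=; apply: eq_bigr => e _.
by rewrite big_cons mulrDr mulrCA.
Qed.

(** At most one [n] has [idx n = k], so the square has no cross terms. *)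
Lemma sqr_normc_sum_delta (s : seq nat) (c : nat -> R[i]) (idx : nat -> nat) k :
    uniq s -> {in s &, injective idx} ->
  normc (\sum_(n <- s) c n * (k == idx n)%:R) ^+ 2 =
  \sum_(n <- s) normc (c n) ^+ 2 * (k == idx n)%:R.
Proof.
elim: s => [|n s IH] /= us idxI; first by rewrite !big_nil normc0 expr0n.
have idxI' : {in s &, injective idx}.
  by move=> m m' ms ms'; apply: idxI; rewrite inE ?ms ?ms' orbT.
have [ns us'] := andP us; rewrite !big_cons; case: eqP => [kn|_]; last first.
  by rewrite !mulr0 !add0r IH.
have z m : m \in s -> (k == idx m) = false.
  move=> ms; apply/negP => /eqP km; move: ns; rewrite (idxI n m) ?ms//.
  - exact: mem_head.
  - by rewrite inE ms orbT.
  - by rewrite -kn.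
rewrite !big_seq !big1 ?addr0 ?mulr1// => m ms; by rewrite z// mulr0.
Qed.

Lemma real_norm_sum_delta (s : seq nat) (c : nat -> R[i]) (idx : nat -> nat) :
    uniq s -> {in s &, injective idx} ->
  real_norm (\sum_(n <- s) c n *: l2_delta R (idx n)) ^+ 2 <= \sum_(n <- s) normc (c n) ^+ 2.
Proof.
move=> us idxI; set V := \sum_(n <- s) normc _ ^+ 2.
have V0 : 0 <= V by apply: sumr_ge0 => *; exact: sqr_ge0.
rewrite -[leRHS](sqr_sqrtr V0) ler_sqr ?nnegrE ?real_norm_ge0 ?sqrtr_ge0//.
apply: real_norm_le => K; rewrite head_norm_leP ?sqrtr_ge0// sqr_sqrtr// /sqsum.
under eq_bigr do rewrite l2_sumE sqr_normc_sum_delta//.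
rewrite exchange_big/=; apply: ler_sum => n _;
  rewrite -mulr_sumr ler_piMr ?sqr_ge0//.
have -> : \sum_(0 <= k < K) (k == idx n)%:R =
  \sum_(0 <= k < K | k == idx n) 1 :> R.
  by rewrite [RHS]big_mkcond; apply: eq_bigr => k _; case: eqP.
by rewrite big_nat1_eq; case: ifP.
Qed.

(** [T] is the operator on ordinary series and [M] the matrix of the one to be built: [M n k] is the
    coefficient of lam k ^ (- s) in the image of lam n ^ (- s), and [b x] collects the coefficients
    of x ^ (- phi). *)
Variables (lam Q : nat -> R) (N : nat -> nat) (c0 : nat) (phi : R[i] -> R[i]).
Variables (b : R -> nat -> R[i]) (M : nat -> nat -> R[i]) (T : {linear l2 R ->
  l2 R}).
Hypothesis lam_incr : {homo lam : m n / (m < n)%N >-> m < n}.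
Hypothesis lamE : forall n, lam n = Q n * (N n)%:R.
Hypothesis Q_ge1 : forall n, 1 <= Q n.
Hypothesis N_gt0 : forall n, (0 < N n)%N.
Hypothesis Q_inj : forall c m n a b, (0 < c)%N -> (0 < a)%N -> (0 < b)%N ->
  Q m ^+ c * a%:R = Q n ^+ c * b%:R -> Q m = Q n.
Hypothesis phiG : class_G_ge1 c0 phi.
Hypothesis bE : forall x, 1 <= x -> has_dcoef (b x) (fun s => cpow x (- phi s)).
Hypothesis T_comp : composition_operator_H2 c0 phi T.
Hypothesis M_eq : forall n k m, lam k = lam n ^+ c0 * m.+1%:R ->
  M n k = b (lam n) m.+1.
Hypothesis M_eq0 : forall n k, (forall m, lam k <> lam n ^+ c0 * m.+1%:R) ->
  M n k = 0.

Lemma lam_inj : injective lam.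
Proof.
move=> m n mn; apply/eqP; case: ltngtP => // /lam_incr; by rewrite mn ltxx.
Qed.

Lemma lam_ge1 n : 1 <= lam n.
Proof. by rewrite lamE -[leLHS]mulr1 ler_pM// ler1n. Qed.

Lemma c0_gt0 : (0 < c0)%N. Proof. by case: phiG. Qed.

Lemma M_neq0 n k : M n k != 0 -> exists m, lam k = lam n ^+ c0 * m.+1%:R.
Proof.
by move=> /eqP Mnk; apply: contrapT => /forallNP h; apply/Mnk/M_eq0.
Qed.

(** A nonzero entry means lam k = lam n ^ c0 * (m + 1), which is at least [lam n]. *)
Lemma M_lower n k : (k < n)%N -> M n k = 0.
Proof.
move=> kn; apply/eqP/contraT => /M_neq0[m kE]; have := lam_incr kn.
rewrite kE ltNge -[X in X <= _]mulr1 ler_pM ?ler1n//;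
  first exact: le_trans (lam_ge1 n).
by rewrite ler_eXnr ?c0_gt0 ?lam_ge1.
Qed.

(** Since lam n = (x / n0) * (n0 * N n), both sides are coefficients of the same product of powers,
    and [has_dcoef_inj] identifies them. *)
Lemma dconv_block x n j : 1 <= x -> Q n = x -> (0 < j)%N ->
  let n0 := Num.truncn x in
  dconv (b (x / n0%:R))
    (dconv (ddelta R ((n0 * N n) ^ c0)%N) (b (n0 * N n)%N%:R)) j =
  dconv (ddelta R (n0 ^ c0)%N) (dconv (ddelta R (N n ^ c0)%N) (b (lam n))) j.
Proof.
move=> x1 Qx j0 n0; have n00 : (0 < n0)%N by rewrite truncn_gt0.
have n0p : 0 < n0%:R :> R by rewrite ltr0n.
have Np : 0 < (N n)%:R :> R by rewrite ltr0n N_gt0.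
have n0x : n0%:R <= x by have /andP[] := truncn_itv (le_trans ler01 x1).
have y1 : 1 <= x / n0%:R by rewrite ler_pdivlMr// mul1r.
have nN0 : (0 < n0 * N n)%N by rewrite muln_gt0 n00 N_gt0.
pose g s := cpow (x / n0%:R) (- phi s) *
  (cpow ((n0 * N n) ^ c0)%N%:R (- s) * cpow (n0 * N n)%N%:R (- phi s)).
apply: (@has_dcoef_inj _ _ _ g) => //.
  apply: has_dcoefM (bE y1) _; apply: has_dcoefM; last by apply: bE;
    rewrite ler1n.
  by apply/dpoly_has_dcoef/dpoly_delta; rewrite expn_gt0 nN0.
rewrite (_ : g = fun s => cpow (n0 ^ c0)%N%:R (- s) *
    (cpow (N n ^ c0)%N%:R (- s) * cpow (lam n) (- phi s))).
  apply: has_dcoefM; first by apply/dpoly_has_dcoef/dpoly_delta;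
    rewrite expn_gt0 n00.
  apply: has_dcoefM (bE (lam_ge1 n)).
  by apply/dpoly_has_dcoef/dpoly_delta; rewrite expn_gt0 N_gt0.
apply/funext => s; rewrite /g mulrCA.
have -> : lam n = x / n0%:R * (n0 * N n)%N%:R.
  by rewrite lamE Qx natrM mulrA divfK// lt0r_neq0.
rewrite [RHS]mulrA expnMn [(_ * _ ^ c0)%N%:R]natrM.
have nNp : 0 < (n0 * N n)%N%:R :> R by rewrite ltr0n.
have yp : 0 < x / n0%:R by rewrite (lt_le_trans _ y1).
by rewrite !natrX !(cpowM _ (exprn_gt0 _ _) (exprn_gt0 _ _))// (cpowM _ yp nNp).
Qed.

(** Within the class of [x], rows are indexed by the integer [P], and column [n] becomes the
    ordinary series N n ^ (- c0 s) * lam n ^ (- phi). *)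
Lemma M_dconv n k P x : Q n = x -> (0 < P)%N -> lam k = x ^+ c0 * P%:R ->
  M n k = dconv (ddelta R (N n ^ c0)%N) (b (lam n)) P.
Proof.
move=> Qx P0 kE; have Nc0 : (0 < N n ^ c0)%N by rewrite expn_gt0 N_gt0.
have x0 : x ^+ c0 != 0 by rewrite expf_neq0// lt0r_neq0// -Qx (lt_le_trans _ (Q_ge1 n)).
have lE m : lam n ^+ c0 * m%:R = x ^+ c0 * (N n ^ c0 * m)%N%:R.
  by rewrite lamE Qx exprMn natrM natrX mulrA.
rewrite dconv_delta//; case: ifPn => [/dvdnP[m PE]|ND].
  have m0 : (0 < m)%N by move: P0; rewrite PE muln_gt0 => /andP[].
  rewrite PE mulnK// -(prednK m0); apply: M_eq.
  by rewrite prednK// lE kE PE mulnC.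
apply: M_eq0 => m; rewrite kE lE => /(mulfI x0)/eqP; rewrite eqr_nat => /eqP PE.
by move: ND; rewrite PE dvdn_mulr.
Qed.

(** The class is carried to the ordinary series [h], whose coefficient at the integer n0 * N n is
    [a n]. The smallness of [T] on [h] and the contraction by (x / n0) ^ (- phi) bound [v], in which
    every nonzero row sum reappears at an index of its own. *)
Lemma block_bound L (eta : R) x K (a : nat -> R[i])
    (s := [seq n <- iota 0 K | Q n == x]) :
    (forall f : l2 R, finite_support f -> (forall n, (n < L)%N -> f n = 0) ->
       real_norm (T f) <= eta * real_norm f) ->
    0 <= eta -> 1 <= x ->
    (forall n, a n != 0 -> 2 * L%:R <= lam n) ->
  \sum_(k <- iota 0 K) normc (\sum_(n <- s) a n * M n k) ^+ 2 <=
  eta ^+ 2 * \sum_(n <- s) normc (a n) ^+ 2.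
Proof.
move=> TL e0 x1 aL; pose n0 := Num.truncn x.
have us : uniq s by rewrite filter_uniq// iota_uniq.
have sQ n : n \in s -> Q n = x by rewrite mem_filter => /andP[/eqP].
have n00 : (0 < n0)%N by rewrite truncn_gt0.
have n0p : 0 < n0%:R :> R by rewrite ltr0n.
have /andP[n0x xn0] := truncn_itv (le_trans ler01 x1).
have y1 : 1 <= x / n0%:R by rewrite ler_pdivlMr// mul1r.
have nN0 n : (0 < n0 * N n)%N by rewrite muln_gt0 n00 N_gt0.
pose i n := (n0 * N n).-1.
have iI : {in s &, injective i}.
  move=> m n ms ns /(congr1 S); rewrite !prednK// => /eqP;
    rewrite eqn_pmul2l// => /eqP NE.
  by apply: lam_inj; rewrite !lamE NE (sQ m)// (sQ n).
pose h : l2 R := \sum_(n <- s) a n *: l2_delta R (i n).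
have hE k : h k = \sum_(n <- s) a n * (k == i n)%:R by exact: l2_sumE.
have hfin : finite_support h.
  exists (\max_(n <- s) i n).+1 => k hk; rewrite hE big_seq big1// => n ns.
  by rewrite gtn_eqF ?mulr0// (leq_trans _ hk)// ltnS; exact: leq_bigmax_seq.
have hL k : (k < L)%N -> h k = 0.
  move=> kL; rewrite hE big_seq big1// => n ns; have [->|an] := eqVneq (a n) 0.
    by rewrite mul0r.
  have := aL n an; rewrite lamE (sQ n ns) => LN.
  rewrite ltn_eqF ?mulr0// /i (leq_trans kL)// -ltnS prednK//.
  rewrite -(ltr_nat R) natrM.
  have Np : 0 < (N n)%:R :> R by rewrite ltr0n N_gt0.
  (* Combined with 2 L <= lam n = x * N n this gives L < n0 * N n: [h] has no coefficient of index
     below [L]. *)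
  have x2 : x < 2 * n0%:R.
    by apply: lt_le_trans xn0 _; rewrite -natrM ler_nat -/n0; lia.
  have := ltr_pM2r Np x (2 * n0%:R); rewrite x2 => h';
    have : x * (N n)%:R < 2 * n0%:R * (N n)%:R by rewrite h'.
  rewrite -mulrA; lra.
have ThE j : (0 < j)%N -> T h j.-1 =
    \sum_(n <- s) a n * dconv (ddelta R ((n0 * N n) ^ c0)%N) (b (n0 * N n)%N%:R) j.
  move=> j0; rewrite /h linear_sum/= l2_sumE; apply: eq_bigr => n _.
  rewrite linearZ/= -[LHS]/(_ * T _ _); congr (_ * _).
  have -> : (n0 * N n)%N = (i n).+1 by rewrite prednK.
  apply: composition_delta phiG T_comp _ j0; apply: bE; by rewrite ler1n.
pose v := dconv (b (x / n0%:R)) (fun j => T h j.-1).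
have vE j : (0 < j)%N -> v j = \sum_(n <- s) a n *
    dconv (ddelta R (n0 ^ c0)%N) (dconv (ddelta R (N n ^ c0)%N) (b (lam n))) j.
  move=> j0; rewrite /v (eq_dconv (a' := b (x / n0%:R)) (b' :=
    fun j => \sum_(n <- s) a n *
    dconv (ddelta R ((n0 * N n) ^ c0)%N) (b (n0 * N n)%N%:R) j)); last first.
    by move=> k /andP[k0 _]; rewrite ThE.
  rewrite dconv_sum big_seq [RHS]big_seq; apply: eq_bigr => n ns; congr (_ * _).
  exact: dconv_block (sQ n ns) j0.
pose S k := \sum_(n <- s) a n * M n k.
have n0c : (0 < n0 ^ c0)%N by rewrite expn_gt0 n00.
(* The row with lam k = x ^ c0 * P goes to index n0 ^ c0 * P of [v]; the value 0 for vanishing row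
   sums is a placeholder. *)
have /choice[idx hidx] : forall k, exists j, S k != 0 ->
    [/\ (0 < j)%N, lam k * (n0 ^ c0)%N%:R = x ^+ c0 * j%:R & S k = v j].
  move=> k; have [S0|Sk] := eqVneq (S k) 0; first by exists 0%N.
  have [n ns Mn] : exists2 n, n \in s & M n k != 0.
    apply: contrapT => hn; move/eqP: Sk; apply;
      rewrite /S big_seq big1// => n ns.
    have [->|Mn] := eqVneq (M n k) 0; first by rewrite mulr0.
    by exfalso; apply: hn; exists n.
  have [m kE] := M_neq0 Mn; pose P := (N n ^ c0 * m.+1)%N.
  have P0 : (0 < P)%N by rewrite muln_gt0 expn_gt0 N_gt0.
  have {}kE : lam k = x ^+ c0 * P%:R.
    by rewrite kE lamE (sQ n ns) exprMn /P natrM natrX mulrA.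
  exists (n0 ^ c0 * P)%N => _; have j0 : (0 < n0 ^ c0 * P)%N
    by rewrite muln_gt0 n0c.
  split=> //; first by rewrite kE natrM -mulrA [P%:R * _]mulrC.
  rewrite vE// /S big_seq [RHS]big_seq; apply: eq_bigr => m' ms; congr (_ * _).
  by rewrite (M_dconv (sQ m' ms) P0 kE) [RHS]dconv_delta// dvdn_mulr// mulKn.
pose s' := [seq k <- iota 0 K | S k != 0].
have s'S k : k \in s' -> S k != 0 by rewrite mem_filter => /andP[].
have -> : \sum_(k <- iota 0 K) normc (S k) ^+ 2 =
  \sum_(k <- s') normc (v (idx k)) ^+ 2.
  rewrite /s' big_filter [RHS]big_mkcond; apply: eq_bigr => k _.
  case: eqVneq => [->|/= Sk]; first by rewrite normc0 expr0n.
  by have [_ _ <-] := hidx k Sk.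
pose J := (\max_(k <- s') idx k).+1.
apply: (@le_trans _ _ (\sum_(1 <= j < J) normc (v j) ^+ 2)).
  apply: (@sum_inj_le s' (fun j => normc (v j) ^+ 2)).
  - by rewrite filter_uniq// iota_uniq.
  - move=> k k' /s'S ks /s'S ks' kk'; have [_ e1 _] := hidx k ks.
    have [_ e2 _] := hidx k' ks'; apply: lam_inj.
    have n0cR : (n0 ^ c0)%N%:R != 0 :> R by rewrite pnatr_eq0 -lt0n.
    by apply: (mulIf n0cR); rewrite e1 e2 kk'.
  - move=> k ks; have [-> _ _] := hidx k (s'S k ks).
    by rewrite ltnS; exact: leq_bigmax_seq.
  - by move=> j; exact: sqr_ge0.
apply: le_trans (has_dcoef_contraction _ J (bE y1) _) _.
  by move=> z z0; apply: multiplier_le1 phiG y1 z0.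
rewrite big_add1/= -/(sqsum (T h) _) -head_norm_sqr.
apply: (@le_trans _ _ ((eta * real_norm h) ^+ 2)).
  rewrite ler_sqr ?nnegrE ?head_norm_ge0 ?mulr_ge0 ?real_norm_ge0//.
  exact: le_trans (head_norm_le_real_norm _ _) (TL h hfin hL).
by rewrite exprMn ler_wpM2l ?sqr_ge0//; exact: real_norm_sum_delta.
Qed.

(** It serves twice: with L = 0 and a bound of [T] for boundedness, and with the [L] provided by
    compactness for smallness. *)
Lemma tri_bound L (eta : R) K (a : nat -> R[i]) :
    (forall f : l2 R, finite_support f -> (forall n, (n < L)%N -> f n = 0) ->
       real_norm (T f) <= eta * real_norm f) ->
    0 <= eta -> (forall n, a n != 0 -> 2 * L%:R <= lam n) ->
  head_norm (tri_apply M a) K <= eta * head_norm a K.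
Proof.
move=> TL e0 aL; rewrite head_norm_leP ?mulr_ge0 ?head_norm_ge0// exprMn head_norm_sqr /sqsum /index_iota subn0.
pose r := undup (map Q (iota 0 K)).
pose S x k := \sum_(n <- [seq n <- iota 0 K | Q n == x]) a n * M n k.
have triE k : (k < K)%N -> tri_apply M a k = \sum_(n <- iota 0 K) a n * M n k.
  move=> kK; rewrite -(subnKC kK) iotaD big_cat/=.
  rewrite /tri_apply /index_iota subn0 -[LHS]addr0; congr (_ + _).
  rewrite big_seq big1// => n; rewrite mem_iota add0n => /andP[kn _].
  by rewrite M_lower ?mulr0.
(* All columns with a nonzero entry in row [k] lie in one class by [Q_inj], so the row sum is a
   single [S x k]. *)
have main k : k \in iota 0 K -> normc (tri_apply M a k) ^+ 2 <= \sum_(x <- r) normc (S x k) ^+ 2.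
  rewrite mem_iota add0n => /andP[_ kK]; rewrite triE//.
  have [[n nK Mn]|hn] := pselect (exists2 n, n \in iota 0 K & M n k != 0);
    last first.
    rewrite big_seq big1 ?normc0 ?expr0n/=; first by apply: sumr_ge0 => *;
      exact: sqr_ge0.
    move=> n nK; have [->|Mn] := eqVneq (M n k) 0; first by rewrite mulr0.
    by exfalso; apply: hn; exists n.
  have -> : \sum_(n <- iota 0 K) a n * M n k = S (Q n) k.
    rewrite /S big_filter [RHS]big_mkcond; apply: eq_bigr => m _;
      case: eqP => // Qm.
    have [->|Mm] := eqVneq (M m k) 0; first by rewrite mulr0.
    have [p pE] := M_neq0 Mn; have [p' pE'] := M_neq0 Mm; exfalso; apply: Qm.
    apply: (@Q_inj c0 _ _ (N m ^ c0 * p'.+1) (N n ^ c0 * p.+1));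
      rewrite ?c0_gt0 ?muln_gt0 ?expn_gt0 ?N_gt0//.
    by rewrite !natrM !natrX !mulrA -!exprMn -!lamE -pE -pE'.
  rewrite (bigD1_seq (Q n)) ?undup_uniq ?mem_undup ?map_f//= lerDl.
  by apply: sumr_ge0 => *; exact: sqr_ge0.
apply: (@le_trans _ _ (\sum_(k <- iota 0 K) \sum_(x <- r) normc (S x k) ^+ 2)).
  by rewrite big_seq [leRHS]big_seq; apply: ler_sum => k; exact: main.
rewrite exchange_big/=.
apply: (@le_trans _ _ (\sum_(x <- r) eta ^+ 2 *
    \sum_(n <- [seq n <- iota 0 K | Q n == x]) normc (a n) ^+ 2)).
  rewrite big_seq [leRHS]big_seq; apply: ler_sum => x.
  rewrite mem_undup => /mapP[n _ ->]; exact: block_bound TL e0 (Q_ge1 n) aL.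
rewrite -mulr_sumr ler_wpM2l ?sqr_ge0//.
under [leLHS]eq_bigr do rewrite big_filter big_mkcond.
rewrite exchange_big/= big_seq [leRHS]big_seq; apply: ler_sum => n nK.
rewrite (bigD1_seq (Q n)) ?undup_uniq ?mem_undup ?map_f//= eqxx big1 ?addr0//.
by move=> x xQ; rewrite eq_sym (negbTE xQ).
Qed.

End BlockEstimate.

(** * The composition operator on generalized Dirichlet series *)

Theorem theorem1p2 (R : realType) (q lam : nat -> R) (c0 : nat)
    (phi : R[i] -> R[i]) :
  admissible_generators q ->
  increasing_enumeration lam (generalized_integers q) ->
  class_G_ge1 c0 phi ->
  compact_on_H2 c0 phi ->
  compact_on_H2Lambda lam c0 phi.
Proof.
move=> aq lamP phiG [T [T_comp cT]].
have [lam_incr _] := lamP.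
have [Q [N [lamE Q1 N0 QI]]] := generalized_integer_decomposition aq lamP.
have [b hb] := choice (fun x : R => multiplier_coef x phiG).
have bE x : 1 <= x -> has_dcoef (b x) (fun s => cpow x (- phi s)) by [].
have c00 : (0 < c0)%N by case: phiG.
have lam1 n : 1 <= lam n by rewrite lamE -[leLHS]mulr1 ler_pM// ler1n.
have lc0 n : lam n ^+ c0 != 0.
  by rewrite expf_neq0// lt0r_neq0// (lt_le_trans _ (lam1 n)).
(* The entry is well defined because lam n ^ c0 is nonzero, so [lam k] determines [m]. *)
have /choice[M hM] : forall nk : nat * nat, exists z : R[i],
    (forall m, lam nk.2 = lam nk.1 ^+ c0 * m.+1%:R -> z = b (lam nk.1) m.+1) /\
    ((forall m, lam nk.2 <> lam nk.1 ^+ c0 * m.+1%:R) -> z = 0).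
  move=> [n k] /=; have [[m mE]|nm] := pselect (exists m, lam k =
    lam n ^+ c0 * m.+1%:R).
    exists (b (lam n) m.+1); split=> [m'|/(_ m)//];
      rewrite mE => /(mulfI (lc0 n))/eqP.
    by rewrite eqr_nat => /eqP ->.
  by exists 0; split=> // m mE; exfalso; apply: nm; exists m.
pose M' n k := M (n, k).
have bound := @tri_bound R lam Q N c0 phi b M' T lam_incr lamE Q1 N0 QI phiG bE T_comp
  (fun n k => (hM (n, k)).1) (fun n k => (hM (n, k)).2).
have T_delta n k : T (l2_delta R n) k =
    dconv (ddelta R (n.+1 ^ c0)%N) (b n.+1%:R) k.+1.
  by rewrite -(composition_delta phiG T_comp (hb _) (ltn0Sn k)).
(* The image of the n-th basis vector only involves multiples of (n + 1) ^ c0, which is at least n +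
   1 as [c0] is positive. *)
have T_lower n k : (k < n)%N -> T (l2_delta R n) k = 0.
  move=> kn; rewrite T_delta dconv_delta ?expn_gt0// gtnNdvd//.
  by apply: (@leq_trans n.+1); rewrite // -[leqLHS]expn1 leq_pexp2l.
have T_tri (f : l2 R) L : finite_support f -> (forall n, (n < L)%N ->
  f n = 0) ->
    forall k, (k < L)%N -> T f k = 0.
  move=> [D fD] fL k kL; have -> : f = \sum_(0 <= n < D) f n *: l2_delta R n.
    apply/val_inj/funext => j /=; rewrite l2_sumE.
    transitivity (\sum_(0 <= n < D | n == j) f n).
      by rewrite big_nat1_eq/=; case: ltnP => // /fD ->.
    rewrite big_mkcond; apply: eq_bigr => n _; rewrite -[RHS]/(_ * _) /= eq_sym.
    by case: eqP; rewrite ?mulr1 ?mulr0.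
  rewrite linear_sum/= l2_sumE big1// => n _;
    rewrite linearZ/= -[LHS]/(_ * T _ _).
  have [nL|Ln] := ltnP n L; first by rewrite fL// mul0r.
  by rewrite T_lower ?mulr0// (leq_trans kL).
have tri_bounded : exists2 C, 0 <= C & forall a K, head_norm (tri_apply M' a) K <= C * head_norm a K.
  have [C C0 TC] := continuous_real_norm_bounded T_comp.1; exists C => // a K.
  apply: (bound 0%N) => // n _; by rewrite mulr0 (le_trans _ (lam1 n)).
have tri_small eta : 0 < eta -> exists L, forall a, (forall n, (n < L)%N ->
  a n = 0) ->
    forall K, head_norm (tri_apply M' a) K <= eta * head_norm a K.
  move=> e0; have [L hL] := compact_triangular_small cT T_tri e0.
  (* From index [L'] on, [lam] is at least 2 L, the threshold of [tri_bound]. *)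
  have [L' hL'] := enumeration_unbounded (2 * L%:R) lamP; exists L' => a aL' K.
  apply: (bound L) (ltW e0) _ => // n;
    case: (ltnP n L') => [/aL' -> /eqP//|/hL' //].
have [T' [T'E T'c T'K]] := triangular_operator tri_bounded tri_small.
have T'_delta n k : T' (l2_delta R n) k = M' n k.
  rewrite T'E /tri_apply; transitivity (\sum_(0 <= j < k.+1 | j == n) M' j k).
    rewrite [RHS]big_mkcond; apply: eq_bigr => j _ /=.
    by case: eqP; rewrite ?mul1r ?mul0r.
  (* For k < n the entry is left out of [tri_apply]; it is zero by triangularity. *)
  rewrite big_nat1_eq/=; case: ltnP => // kn.
  by rewrite (M_lower (M := M') lam_incr lamE Q1 N0 phiG (fun n k => (hM (n, k)).2)).
exists T'; split=> //; split=> // n.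
have gle1 s : 0 < Re s -> normc (cpow (lam n) (- phi s)) <= 1.
  exact: multiplier_le1 phiG (lam1 n).
have bl2 : (fun k => b (lam n) k.+1) \in @square_summable R.
  apply: (@head_norm_l2 _ _ 1) => K; rewrite head_norm_leP// expr1n.
  by have := has_dcoef_l2 gle1 K.+1 (hb (lam n)); rewrite big_add1.
exists (L2 bl2); split.
- move=> s s2; apply: dirichlet_cvg_dirichlet_sum.
  have := has_dcoef_eval (hb (lam n)) gle1 (_ : 2^-1 < Re s).
  rewrite -div1r => /(_ s2) h d /h[D hD]; exists D => K DK.
  rewrite (_ : dpsum _ K s = dpsum (b (lam n)) K s); first exact: hD.
  by apply: eq_big_nat => -[].
- by move=> m k kE; rewrite T'_delta; exact: (hM (n, k)).1.
- by move=> k kE; rewrite T'_delta; exact: (hM (n, k)).2.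
Qed.
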